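(* Let $(A,\Vert\cdot\Vert)$ be a regular semisimple commutative Banach algebra. Then every algebra norm on $A$ is a Q-algebra norm on $A$.
   Context: All algebras are over the complex field $\mathbb{C}$ and are not assumed unital. A norm $\vert\cdot\vert$ on an algebra $A$ is an algebra norm if $(A,\vert\cdot\vert)$ is a normed algebra (i.e. the norm is submultiplicative; completeness is not required). An element $x$ is quasi-invertible if there is $y\in A$ with $x+y-xy=x+y-yx=0$. A topological algebra is a Q-algebra if its set of quasi-invertible elements is open; $\vert\cdot\vert$ is a Q-algebra norm on $A$ if $(A,\vert\cdot\vert)$ is a normed algebra that is a Q-algebra for the topology of $\vert\cdot\vert$. Semisimple means that the (Jacobson) radical is zero. For a topological algebra $A$, $M(A)$ denotes the set of all nonzero continuous multiplicative linear functionals $A\to\mathbb{C}$, endowed with the weak topology induced by the topological dual (the topology of pointwise convergence on $A$), and for $x\in A$ the Gelfand transform is $\widehat{x}:M(A)\to\mathbb{C}$, $\widehat{x}(g)=g(x)$. A topological algebra $A$ is regular if for every closed subset $F\subset M(A)$ and every $f_{1}\in M(A)$ with $f_{1}\notin F$ there exists $x\in A$ such that $\widehat{x}_{\vert F}=0$ and $\widehat{x}(f_{1})\neq 0$. Here regularity of $(A,\Vert\cdot\Vert)$ refers to the norm topology of $\Vert\cdot\Vert$. *)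

(* Defs.v *)
(* The complex field is R[i], for R : realType. *)
From HB Require Import structures.
From mathcomp Require Import all_boot all_order all_algebra.
From mathcomp Require Import all_classical all_reals all_analysis.
From mathcomp Require Export complex.

Set Implicit Arguments.
Unset Strict Implicit.
Unset Printing Implicit Defensive.

Import Order.TTheory GRing.Theory Num.Theory.
Import numFieldNormedType.Exports.

Local Open Scope classical_set_scope.
Local Open Scope ring_scope.

(* MathComp's algType is unital, hence this hierarchy of associative algebras
   without a unit. *)
HB.mixin Record Lmodule_isNonUnitalAlgebra (K : numFieldType) A
    & GRing.Lmodule K A := {
  amul : A -> A -> A;
  amulA : associative amul;
  amulDl : left_distributive amul +%R;
  amulDr : right_distributive amul +%R;
  amulZl : forall (a : K) (x y : A), amul (a *: x) y = a *: amul x y;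
  amulZr : forall (a : K) (x y : A), amul x (a *: y) = a *: amul x y
}.

#[short(type="nuAlgType")]
HB.structure Definition NonUnitalAlgebra (K : numFieldType) :=
  {A of GRing.Lmodule K A & Lmodule_isNonUnitalAlgebra K A}.

HB.mixin Record isSubmultiplicative (K : numFieldType) A
    & NormedModule K A & NonUnitalAlgebra K A := {
  ler_normAM : forall x y : A, `|amul x y| <= `|x| * `|y|
}.

#[short(type="normedAlgType")]
HB.structure Definition NormedAlgebra (K : numFieldType) :=
  {A of NormedModule K A & NonUnitalAlgebra K A & isSubmultiplicative K A}.

#[short(type="banachAlgType")]
HB.structure Definition BanachAlgebra (K : numFieldType) :=
  {A of CompleteNormedModule K A & NormedAlgebra K A}.

Section Radical.
Variables (K : numFieldType) (A : nuAlgType K).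

Definition quasi_invertible (x : A) :=
  exists y : A, x + y - amul x y = 0 /\ x + y - amul y x = 0.

Definition left_ideal (I : set A) :=
  [/\ I 0,
      forall (a : K) (x y : A), I x -> I y -> I (a *: x + y) &
      forall a x : A, I x -> I (amul a x)].

Definition modular (I : set A) := exists e : A, forall x, I (x - amul x e).

(* A left ideal containing a modular one is modular, so maximality among
   proper left ideals and among proper modular left ideals coincide. *)
Definition maximal_modular_left_ideal (I : set A) :=
  [/\ left_ideal I, modular I, I != setT &
      forall J, left_ideal J -> I `<=` J -> J = I \/ J = setT].

(* With no maximal modular left ideal the intersection is the whole of A, as
   usual for radical algebras. *)
Definition jacobson_radical : set A :=
  \bigcap_(I in maximal_modular_left_ideal) I.

Definition semisimple := jacobson_radical = [set 0].

End Radical.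

Arguments jacobson_radical {K} A.
Arguments semisimple {K} A.

Section Spectrum.
Variables (K : numFieldType) (A : normedAlgType K).

Definition is_character (g : A -> K^o) :=
  [/\ linear g,
      forall x y, g (amul x y) = g x * g y,
      continuous g &
      exists x, g x != 0].

(* As a set of {ptws A -> K^o}, the spectrum coerces to a type carrying the
   subspace topology of pointwise convergence. *)
Definition spectrum : set {ptws A -> K^o} := [set g | is_character g].

Definition gelfand (x : A) : spectrum -> K^o := fun g => set_val g x.

Definition regular :=
  forall (F : set spectrum) (f1 : spectrum), closed F -> ~ F f1 ->
  exists x : A, (forall f, F f -> gelfand x f = 0) /\ gelfand x f1 != 0.

Definition Q_algebra := open [set x : A | quasi_invertible x].

End Spectrum.

Arguments spectrum {K} A.
Arguments regular {K} A.
Arguments Q_algebra {K} A.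

(* As for the norms of normedModType K, the values lie in K; they are
   nonnegative by the triangle inequality applied to x and - x. *)
Record algebra_norm (K : numFieldType) (A : nuAlgType K) := AlgebraNorm {
  anorm :> A -> K;
  ler_anormD : forall x y, anorm (x + y) <= anorm x + anorm y;
  anormZ : forall (a : K) (x : A), anorm (a *: x) = `|a| * anorm x;
  anorm0_eq0 : forall x, anorm x = 0 -> x = 0;
  ler_anormM : forall x y, anorm (amul x y) <= anorm x * anorm y
}.

(* The algebra A with the norm nu and the topology of nu, forgetting any norm
   that A may already carry. *)
Definition renormed (K : numFieldType) (A : nuAlgType K)
  (nu : algebra_norm A) : Type := A.

Section Renormed.
Variables (K : numFieldType) (A : nuAlgType K) (nu : algebra_norm A).

HB.instance Definition _ := NonUnitalAlgebra.copy (renormed nu) A.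

HB.instance Definition _ := Lmodule_isNormed.Build K (renormed nu)
  (@ler_anormD _ _ nu) (@anormZ _ _ nu) (@anorm0_eq0 _ _ nu).

HB.instance Definition _ :=
  isSubmultiplicative.Build K (renormed nu) (@ler_anormM _ _ nu).

End Renormed.

Definition Q_algebra_norm (K : numFieldType) (A : nuAlgType K)
  (nu : algebra_norm A) := Q_algebra (renormed nu).

(* Main.v *)
Require Import Defs.
From mathcomp Require Import all_boot all_order all_algebra.
From mathcomp Require Import all_classical all_reals all_analysis.
From mathcomp Require Import ring lra.
From HB Require Import structures.

Set Implicit Arguments.
Unset Strict Implicit.
Unset Printing Implicit Defensive.

Import Order.TTheory GRing.Theory Num.Theory.
Import numFieldNormedType.Exports.

Local Open Scope classical_set_scope.
Local Open Scope ring_scope.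

(** Write [V x] for the set of characters [psi] with [psi x] within [1 / 32] of
    [1], and [J] for the ideal of the elements vanishing on [V x]; regularity
    says that the characters killing [J] are exactly those of [V x].

    Every element [x] with [nu x < 1 / 2] is quasi-invertible; this gives
    openness, since [1 - (x + h)] is [1 - x] times [1 - w] with [w] small as soon
    as [1 - x] is invertible and [h] is small for [nu]. Indeed, if [x] is not quasi-invertible,
    some character takes at [x] a value of modulus at least [1], and after rescaling
    the value [1], while still [nu x < 1 / 2]. Regularity gives [u] that is
    nonzero at this character and vanishes off [V x], and a local unit [y] equal
    to [1] on [V x], so [y u = u] and [J u = 0] by semisimplicity. Then
    [(y ^ n - j) u = u] for all [j] in [J], hence [nu (y ^ n - j) >= 1]: in the
    quotient seminorm of [nu] by [J] the powers of [y] do not become small. So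
    there is a nonzero character [psi] bounded by [nu] and killing [J]. It lies
    in [V x], which contradicts [|psi x| <= nu x < 1 / 2].

    This uses Gelfand theory for seminorms that need not be complete, which is
    [exists_character]: if a submultiplicative seminorm [p] is at least [1] on
    all powers of [x], some character [chi] satisfies [|chi| <= p] and
    [|chi x| >= 1]. By Zorn's lemma there is a minimal such seminorm [q] below
    [p]. Passing to the spectral radius of [q], and to the limit of
    [q (a ^ n b) / q a ^ n], cannot make it smaller, so [q] is multiplicative. A
    multiplicative seminorm is the modulus of a character by an elementary form
    of the Gelfand-Mazur theorem, which needs no completeness and only uses that
    ['X^n - c ^ n] splits. The same statement, applied to the Banach norm and to its
    quotients, also stands for the spectral radius formula of Banach algebras.

    The local unit ([local_unit]) is obtained as the idempotent modulo [J] near [x]: on [V x]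
    the transform of [x - x ^ 2] is small, so [x - x ^ 2] has small spectral radius
    modulo [J] and the Newton iteration [e -> 3 e ^ 2 - 2 e ^ 3] started at [x]
    converges modulo [J]. Its increments lift to a convergent series in the
    Banach algebra, and on [V x] the scalar iteration converges to [1].

    All norms and seminorms are handled as functions with real values, and
    quasi-invertibility of [a] as invertibility of [1 - a] in the unitization,
    where the ring theory of commutative rings applies. *)

(** * Geometric sequences and the modulus of a complex number *)

Lemma geometric_small (R : realType) (C r e : R) : 0 <= r < 1 -> 0 < e ->
  exists N, forall n, (N <= n)%N -> C * r ^+ n < e.
Proof.
move=> /andP[r0 r1] e0.
have /cvgrPdist_lt/(_ _ e0)[N _ CN] : geometric C r @ \oo --> (0 : R).
  by apply: cvg_geometric; rewrite ger0_norm.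
exists N => n /CN; rewrite /= sub0r normrN.
by apply: le_lt_trans; rewrite ler_norm.
Qed.

Lemma geometric_tail (R : realType) (C r : R) m n : 0 <= C -> 0 <= r < 1 ->
  \sum_(m <= k < n) C * r ^+ k <= C / (1 - r) * r ^+ m.
Proof.
move=> C0 /andP[r0 r1]; have r1' : 0 < 1 - r by rewrite subr_gt0.
have [nm|/ltnW mn] := leqP n m.
  by rewrite big_geq// mulr_ge0 ?exprn_ge0 ?divr_ge0// ltW.
have -> : \sum_(m <= k < n) C * r ^+ k = C / (1 - r) * (r ^+ m - r ^+ n).
  rewrite -(subnKC mn); elim: (n - m)%N => [|k IH].
    by rewrite addn0 big_geq// subrr mulr0.
  rewrite addnS big_nat_recr ?leq_addr//= IH [r ^+ (m + k).+1]exprS.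
  field; rewrite gt_eqF//.
by rewrite ler_wpM2l ?divr_ge0 ?(ltW r1')// gerBl exprn_ge0.
Qed.

Section ComplexModulus.
Variable R : realType.
Implicit Types c d : R[i].

(** The norm of [R[i]] has its values in [R[i]], where infima do not exist. *)
Definition cmod c : R := complex.Re `|c|.

Lemma cmodE c : `|c| = (cmod c)%:C%C.
Proof. by []. Qed.

Lemma cmodD c d : cmod (c + d) <= cmod c + cmod d.
Proof. by rewrite -lecR rmorphD /= -!cmodE ler_normD. Qed.

Lemma cmodM c d : cmod (c * d) = cmod c * cmod d.
Proof. by apply: (@complexI R); rewrite rmorphM /= -!cmodE normrM. Qed.

Lemma cmodN c : cmod (- c) = cmod c.
Proof. by rewrite /cmod normrN. Qed.

Lemma cmodB c d : cmod (c - d) = cmod (d - c).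
Proof. by rewrite /cmod distrC. Qed.

Lemma cmod_ge0 c : 0 <= cmod c.
Proof. by rewrite -lecR -cmodE normr_ge0. Qed.

Lemma cmod0 : cmod 0 = 0.
Proof. by rewrite /cmod normr0. Qed.

Lemma cmod1 : cmod 1 = 1.
Proof. by rewrite /cmod normr1. Qed.

Lemma cmod_real (r : R) : 0 <= r -> cmod r%:C%C = r.
Proof. by move=> r0; rewrite /cmod ger0_norm ?ler0c. Qed.

Lemma cmod_eq0 c : cmod c = 0 -> c = 0.
Proof. by move=> c0; apply/eqP; rewrite -normr_eq0 cmodE c0. Qed.

Lemma cmod_gt0 c : (0 < cmod c) = (c != 0).
Proof. by rewrite -ltcR -cmodE normr_gt0. Qed.

Lemma cmodX c n : cmod (c ^+ n) = cmod c ^+ n.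
Proof. by elim: n => [|n IH]; rewrite ?expr0 ?cmod1// !exprS cmodM IH. Qed.

Lemma cmodV c : cmod c^-1 = (cmod c)^-1.
Proof.
have [->|c0] := eqVneq c 0; first by rewrite invr0 cmod0 invr0.
have m0 : cmod c != 0 by rewrite gt_eqF// cmod_gt0.
by apply: (mulfI m0); rewrite -cmodM !mulfV// cmod1.
Qed.

Lemma cmod_ge_Re c : complex.Re c <= cmod c.
Proof.
case: c => x y; rewrite /cmod /= (le_trans (ler_norm x))// -sqrtr_sqr.
by rewrite ler_wsqrtr// lerDl sqr_ge0.
Qed.

Lemma cmod_ge_Im c : complex.Im c <= cmod c.
Proof.
case: c => x y; rewrite /cmod /= (le_trans (ler_norm y))// -sqrtr_sqr.
by rewrite ler_wsqrtr// lerDr sqr_ge0.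
Qed.

Lemma cmod_le_ReIm (x y e : R) :
  - e <= x <= e -> - e <= y <= e -> cmod (x +i* y)%C <= 2 * e.
Proof.
move=> xe ye; rewrite /cmod /=.
have e0 : 0 <= 2 * e by lra.
rewrite -[leRHS]ger0_norm// -sqrtr_sqr ler_wsqrtr//.
have : x ^+ 2 <= e ^+ 2 by nra.
have : y ^+ 2 <= e ^+ 2 by nra.
rewrite exprMn; nra.
Qed.

End ComplexModulus.

(** * Submultiplicative seminorms *)

Section AlgebraSeminorm.
Variables (R : realType) (E : comAlgType R[i]).
Implicit Types (q : E -> R) (a b e f x : E) (c : R[i]).

Definition algebra_seminorm q :=
  [/\ forall a b, q (a + b) <= q a + q b,
      forall c a, q (c *: a) = cmod c * q a &
      forall a b, q (a * b) <= q a * q b].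

Section Theory.
Variables (q : E -> R) (qP : algebra_seminorm q).

Lemma seminormD a b : q (a + b) <= q a + q b. Proof. by case: qP. Qed.

Lemma seminormZ c a : q (c *: a) = cmod c * q a. Proof. by case: qP. Qed.

Lemma seminormM a b : q (a * b) <= q a * q b. Proof. by case: qP. Qed.

Lemma seminorm0 : q 0 = 0.
Proof. by rewrite -(scale0r 0) seminormZ cmod0 mul0r. Qed.

Lemma seminormN a : q (- a) = q a.
Proof. by rewrite -scaleN1r seminormZ cmodN cmod1 mul1r. Qed.

Lemma seminormB a b : q (a - b) <= q a + q b.
Proof. by rewrite -(seminormN b) seminormD. Qed.

Lemma seminorm_ge0 a : 0 <= q a.
Proof.
by have := seminormB a a; rewrite subrr seminorm0 -mulr2n pmulrn_lge0.
Qed.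

Lemma seminormXM a b n : q (a ^+ n * b) <= q a ^+ n * q b.
Proof.
elim: n => [|n IH]; first by rewrite !expr0 !mul1r.
rewrite !exprS -!mulrA (le_trans (seminormM _ _))//.
by rewrite ler_wpM2l// seminorm_ge0.
Qed.

Lemma seminormX a n : q (a ^+ n.+1) <= q a ^+ n.+1.
Proof. by rewrite !exprSr seminormXM. Qed.

Lemma seminorm_dist a b : q a <= q b + q (a - b).
Proof. by rewrite -{1}(subrK b a) addrC seminormD. Qed.

Lemma seminorm_sum I (r : seq I) (P : pred I) (F : I -> E) :
  q (\sum_(i <- r | P i) F i) <= \sum_(i <- r | P i) q (F i).
Proof.
elim/big_rec2: _ => [|i s a _ sa]; first by rewrite seminorm0.
by rewrite (le_trans (seminormD _ _))// lerD2l.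
Qed.

Lemma seminorm_eq a b : q (a - b) = 0 -> q a = q b.
Proof.
move=> ab0; apply/eqP; rewrite eq_le.
have := seminorm_dist a b; rewrite ab0 addr0 => -> /=.
by have := seminorm_dist b a; rewrite -(opprB a b) seminormN ab0 addr0.
Qed.

End Theory.

(** Spectral radii, quotient seminorms and infima of chains of seminorms are
    all of the form [inf (S a)], so one verification serves for all of them. *)
Lemma inf_seminorm (S : E -> set R) :
  (forall a, S a !=set0) -> (forall a s, S a s -> 0 <= s) ->
  (forall a b s t, S a s -> S b t -> exists2 u, S (a + b) u & u <= s + t) ->
  (forall c a s, S a s -> exists2 u, S (c *: a) u & u <= cmod c * s) ->
  (forall a b s t, S a s -> S b t -> exists2 u, S (a * b) u & u <= s * t) ->
  algebra_seminorm (fun a => inf (S a)).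
Proof.
move=> S0 Sge0 SD SZ SM.
have Slb a : has_lbound (S a) by exists 0 => s; exact: Sge0.
have infS a s : S a s -> inf (S a) <= s by move=> Sas; exact: ge_inf.
have inf_ge0 a : 0 <= inf (S a) by apply: lb_le_inf => // s; exact: Sge0.
have infM a r t : 0 <= t -> (forall s, S a s -> r <= s * t) ->
    r <= inf (S a) * t.
  rewrite le_eqVlt => /predU1P[<-|t0] rS.
    by have [s /rS] := S0 a; rewrite !mulr0.
  rewrite -ler_pdivrMr//; apply: lb_le_inf => // s /rS.
  by rewrite ler_pdivrMr.
have infZ c a : inf (S (c *: a)) <= cmod c * inf (S a).
  rewrite mulrC; apply: infM => [|s /SZ-/(_ c)[u /infS Su us]].
    exact: cmod_ge0.
  by rewrite mulrC (le_trans Su).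
split=> [a b|c a|a b].
- rewrite -lerBlDr; apply: lb_le_inf => // s Ss.
  rewrite lerBlDr -lerBlDl; apply: lb_le_inf => // t St.
  by have [u /infS Su us] := SD _ _ _ _ Ss St; rewrite lerBlDl (le_trans Su).
- apply/eqP; rewrite eq_le infZ /=.
  have [->|c0] := eqVneq c 0; first by rewrite cmod0 mul0r.
  have m0 : 0 < cmod c by rewrite cmod_gt0.
  have := infZ c^-1 (c *: a).
  by rewrite scalerA mulVf// scale1r cmodV mulrC ler_pdivlMr// mulrC.
- apply: (infM) => // s Ss; rewrite [leRHS]mulrC; apply: infM => [|t St].
    exact: Sge0 Ss.
  by have [u /infS Su us] := SM _ _ _ _ Ss St; rewrite [leRHS]mulrC (le_trans Su).
Qed.

Section SpectralSeminorm.
Variables (q : E -> R) (qP : algebra_seminorm q).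

(** The exponential rates bounding the powers of [a]. Their infimum is the
    spectral radius [lim q (a ^+ n) ^ (1 / n)]; in this form no roots are taken and
    subadditivity is the binomial formula. *)
Definition growth_rate a : set R :=
  [set s | 0 <= s /\ exists M, forall n, q (a ^+ n) <= M * s ^+ n].

Definition spectral_seminorm a := inf (growth_rate a).

(** A bound on one power bounds all of them, by division of the exponent. *)
Lemma growth_rate_root a n s :
  0 < s -> q (a ^+ n.+1) <= s ^+ n.+1 -> growth_rate a s.
Proof.
move=> s0 qs; split; first exact: ltW.
exists (\sum_(j < n.+1) q (a ^+ j) / s ^+ j) => m.
rewrite (divn_eq m n.+1) mulnC exprD exprM.
have s_neq0 k : s ^+ k != 0 by rewrite expf_neq0// gt_eqF.
set k := (m %/ n.+1)%N; set j := (m %% n.+1)%N.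
apply: (@le_trans _ _ (s ^+ (n.+1 * k) * q (a ^+ j))).
  apply: (le_trans (seminormXM qP _ _ _)).
  apply: ler_wpM2r; first exact: seminorm_ge0.
  rewrite exprM lerXn2r ?nnegrE ?(seminorm_ge0 qP)// ?exprn_ge0 ?ltW//.
have lt : (j < n.+1)%N by rewrite ltn_mod.
rewrite exprD mulrCA; apply: ler_wpM2l; first by rewrite exprn_ge0// ltW.
rewrite -ler_pdivrMr ?exprn_gt0// (bigD1 (Ordinal lt)) //= lerDl.
by rewrite sumr_ge0// => i _; rewrite divr_ge0 ?exprn_ge0 ?(seminorm_ge0 qP)// ltW.
Qed.

Lemma growth_rate_neq0 a : growth_rate a !=set0.
Proof.
exists (q a + 1); apply: (@growth_rate_root a 0).
  by rewrite ltr_wpDl ?(seminorm_ge0 qP).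
by rewrite !expr1 lerDl.
Qed.

Lemma growth_rateM_ge0 a s : growth_rate a s ->
  exists2 M, 0 <= M & forall n, q (a ^+ n) <= M * s ^+ n.
Proof.
case=> s0 [M qM]; exists M => //.
by have := qM 0; rewrite !expr0 mulr1; apply: le_trans; exact: (seminorm_ge0 qP).
Qed.

Lemma spectral_seminormP : algebra_seminorm spectral_seminorm.
Proof.
apply: inf_seminorm => [a|a s []//|a b s t ra rb|c a s ra|a b s t ra rb].
- exact: growth_rate_neq0.
- have [s0 _] := ra; have [t0 _] := rb; exists (s + t) => //.
  have [M M0 qM] := growth_rateM_ge0 ra; have [N N0 qN] := growth_rateM_ge0 rb.
  split; [exact: addr_ge0|exists (M * N) => n]; rewrite !exprDn.
  apply: le_trans (seminorm_sum qP _ _ _) _; rewrite mulr_sumr.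
  apply: ler_sum => i _; rewrite -scaler_nat (seminormZ qP).
  rewrite mulrnAr -[leRHS]mulr_natl.
  have -> : cmod ('C(n, i)%:R : R[i]) = 'C(n, i)%:R.
    by rewrite -(rmorph_nat (real_complex R)) cmod_real.
  rewrite ler_wpM2l// mulrACA (le_trans (seminormM qP _ _))//.
  by rewrite ler_pM ?(seminorm_ge0 qP).
- have [s0 _] := ra; exists (cmod c * s) => //.
  have [M M0 qM] := growth_rateM_ge0 ra.
  split; [by rewrite mulr_ge0 ?cmod_ge0|exists M => n].
  rewrite exprZn (seminormZ qP) cmodX exprMn mulrCA.
  by rewrite ler_wpM2l// exprn_ge0 ?cmod_ge0.
- have [s0 _] := ra; have [t0 _] := rb; exists (s * t) => //.
  have [M M0 qM] := growth_rateM_ge0 ra; have [N N0 qN] := growth_rateM_ge0 rb.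
  split; [exact: mulr_ge0|exists (M * N) => n]; rewrite !exprMn.
  rewrite mulrACA (le_trans (seminormM qP _ _))//.
  by rewrite ler_pM ?(seminorm_ge0 qP).
Qed.

Lemma spectral_seminorm_le a s : growth_rate a s -> spectral_seminorm a <= s.
Proof. by move=> ra; apply: ge_inf => //; exists 0 => t []. Qed.

Lemma le_spectral_seminorm a : spectral_seminorm a <= q a.
Proof.
apply/ler_addgt0Pr => e e0; apply: spectral_seminorm_le.
apply: (@growth_rate_root a 0); first by rewrite ltr_wpDl ?(seminorm_ge0 qP).
by rewrite !expr1 lerDl ltW.
Qed.

Lemma spectral_seminorm_ge1 x :
  (forall n, 1 <= q (x ^+ n)) -> 1 <= spectral_seminorm x.
Proof.
move=> x1; apply: lb_le_inf; first exact: growth_rate_neq0.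
move=> s sx; have [s0 _] := sx; have [M M0 qM] := growth_rateM_ge0 sx.
rewrite leNgt; apply/negP => s1.
have [N /(_ N (leqnn N))] : exists N, forall n, (N <= n)%N -> M * s ^+ n < 1.
  by apply: geometric_small; rewrite ?s0.
by rewrite ltNge (le_trans (x1 N)).
Qed.

End SpectralSeminorm.

(** * Minimal seminorms are multiplicative *)

Section MinimalSeminorm.

Lemma seminorm1_ge1 q x : algebra_seminorm q -> 1 <= q x -> 1 <= q 1.
Proof.
move=> qP x1; have := seminormM qP 1 x.
by rewrite mul1r ler_pMl// (lt_le_trans ltr01).
Qed.

(** Zorn's lemma: the pointwise infimum of a nonempty chain of admissible
    seminorms is admissible. *)
Lemma minimal_seminorm p x :
  algebra_seminorm p -> (forall n, 1 <= p (x ^+ n)) ->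
  exists q, [/\ algebra_seminorm q, forall a, q a <= p a,
    forall n, 1 <= q (x ^+ n) &
    forall q', algebra_seminorm q' -> (forall a, q' a <= q a) ->
      (forall n, 1 <= q' (x ^+ n)) -> forall a, q' a = q a].
Proof.
move=> pP px.
pose ok q := [/\ algebra_seminorm q, forall a, q a <= p a &
  forall n, 1 <= q (x ^+ n)].
have okp : ok p by split.
pose below (s t : {q | ok q}) := `[< forall a, sval t a <= sval s a >].
have [| | |[q [qP qp qx]] qmin] := @ZL_preorder _ (exist _ p okp) below.
- by move=> s; apply/asboolP.
- move=> r s t /asboolP rs /asboolP st; apply/asboolP => a.
  exact: le_trans (st a) (rs a).
- move=> C Ctot; have [[s0 Cs0]|C0] := pselect (C !=set0); last first.
    by exists (exist _ p okp) => s Cs; exfalso; apply: C0; exists s.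
  pose S a : set R := [set sval s a | s in C].
  have Sge0 a s : S a s -> 0 <= s.
    by move=> [[q [qP ? ?]] Cq <-] /=; exact: seminorm_ge0.
  have Slb a : has_lbound (S a) by exists 0 => s; exact: Sge0.
  have Spair a b s t : S a s -> S b t ->
      exists2 r, C r & sval r a <= s /\ sval r b <= t.
    move=> [r Cr <-] [r' Cr' <-]; have [/asboolP rr|/asboolP rr] := Ctot _ _ Cr Cr'.
      by exists r'.
    by exists r.
  have SP : algebra_seminorm (fun a => inf (S a)).
    apply: inf_seminorm => //.
    + by move=> a; exists (sval s0 a), s0.
    + move=> a b s t Ss St; have [r Cr [ra rb]] := Spair _ _ _ _ Ss St.
      exists (sval r (a + b)); first by exists r.
      case: r Cr ra rb => r [rP ? ?] /= _ ra rb.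
      by rewrite (le_trans (seminormD rP _ _))// lerD.
    + move=> c a s [r Cr <-]; exists (sval r (c *: a)); first by exists r.
      by case: r Cr => r [rP ? ?] /= _; rewrite (seminormZ rP).
    + move=> a b s t Ss St; have [r Cr [ra rb]] := Spair _ _ _ _ Ss St.
      exists (sval r (a * b)); first by exists r.
      case: r Cr ra rb => r [rP ? ?] /= _ ra rb.
      by rewrite (le_trans (seminormM rP _ _))// ler_pM// (seminorm_ge0 rP).
  have Sle s a : C s -> inf (S a) <= sval s a.
    by move=> Cs; apply: ge_inf => //; exists s.
  have okS : ok (fun a => inf (S a)).
    split=> // [a|n].
      by apply: le_trans (Sle _ _ Cs0) _; case: (s0) => ? [].
    apply: lb_le_inf; first by exists (sval s0 (x ^+ n)), s0.
    by move=> _ [[q [? ? qx]] _ <-] /=.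
  exists (exist _ _ okS) => s Cs; apply/asboolP => a /=; exact: Sle.
exists q; split => // q' q'P q'q q'x a.
have okq' : ok q' by split=> // b; exact: le_trans (q'q b) (qp b).
apply/eqP; rewrite eq_le q'q /=.
have /asboolP : below (exist _ q' okq') (exist _ q (And3 qP qp qx)).
  by apply: qmin; apply/asboolP.
by apply.
Qed.

Variables (q : E -> R) (x : E).
Hypotheses (qP : algebra_seminorm q) (qx : forall n, 1 <= q (x ^+ n)).
Hypothesis qmin : forall q', algebra_seminorm q' ->
  (forall a, q' a <= q a) -> (forall n, 1 <= q' (x ^+ n)) ->
  forall a, q' a = q a.

(** The spectral radius of [q] is an admissible seminorm below [q], hence equals
    [q]; but the spectral radius sees [a] and its powers alike. *)
Lemma minimal_seminormX a n : q (a ^+ n.+1) = q a ^+ n.+1.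
Proof.
apply/eqP; rewrite eq_le (seminormX qP) /=; apply/ler_addgt0Pr => e e0.
have sprq : spectral_seminorm q a = q a.
  apply: qmin; first exact: spectral_seminormP.
    exact: le_spectral_seminorm.
  move=> k; apply: spectral_seminorm_ge1 => // m; rewrite -exprM; exact: qx.
set t := q (a ^+ n.+1) + e; have t0 : 0 < t by rewrite ltr_wpDl ?(seminorm_ge0 qP).
(* An [n.+1]-th root of [t], which [growth_rate_root] makes a growth rate. *)
pose s := t `^ n.+1%:R^-1.
have sn : s ^+ n.+1 = t.
  by rewrite -powR_mulrn ?powR_ge0// -powRrM mulVf ?pnatr_eq0// powRr1// ltW.
rewrite -sn lerXn2r ?nnegrE ?(seminorm_ge0 qP) ?powR_ge0//.
rewrite -sprq; apply: spectral_seminorm_le.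
apply: (@growth_rate_root _ qP _ n); first exact: powR_gt0.
by rewrite sn lerDl ltW.
Qed.

Lemma minimal_seminorm1 : q 1 = 1.
Proof.
have := minimal_seminormX 1 1; rewrite expr1n expr2.
have q1 : 1 <= q 1 by have := qx 0; rewrite expr0.
have q1n : q 1 != 0 by rewrite gt_eqF// (lt_le_trans ltr01).
by move/esym; rewrite -{3}[q 1]mulr1 => /(mulfI q1n).
Qed.

(** [b |-> inf_n q (a ^+ n * b) / q a ^+ n] is a seminorm below [q] that makes
    multiplication by [a] isometric up to the factor [q a]; minimality forces
    it to be [q] as soon as it stays at least one on the powers of [x]. *)
Lemma minimal_seminormM_from a : 0 < q a ->
  (forall n k, q a ^+ n <= q (a ^+ n * x ^+ k)) ->
  forall b, q (a * b) = q a * q b.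
Proof.
move=> a0 ax b.
pose S b : set R := [set q (a ^+ n * b) / q a ^+ n | n in setT].
have Sge0 e s : S e s -> 0 <= s.
  by move=> [n _ <-]; rewrite divr_ge0 ?exprn_ge0 ?(seminorm_ge0 qP).
have Slb e : has_lbound (S e) by exists 0 => s; exact: Sge0.
have an0 n : 0 < q a ^+ n by rewrite exprn_gt0.
have Sdec (e : E) n m :
    q (a ^+ (n + m) * e) / q a ^+ (n + m) <= q (a ^+ n * e) / q a ^+ n.
  rewrite addnC ler_pdivrMr// exprD -mulrA (le_trans (seminormXM qP _ _ _))//.
  by rewrite exprD mulrCA mulfVK ?gt_eqF// .
have SP : algebra_seminorm (fun e => inf (S e)).
  apply: inf_seminorm => //.
  + by move=> e; exists (q (a ^+ 0 * e) / q a ^+ 0), 0.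
  + move=> e f _ _ [n _ <-] [m _ <-].
    exists (q (a ^+ (n + m) * (e + f)) / q a ^+ (n + m)); first by exists (n + m)%N.
    apply: le_trans (lerD (Sdec e n m) (Sdec f m n)).
    rewrite [(m + n)%N]addnC -mulrDl ler_pM2r ?invr_gt0// mulrDr; exact: (seminormD qP).
  + move=> e f _ [n _ <-].
    exists (q (a ^+ n * (e *: f)) / q a ^+ n); first by exists n.
    by rewrite -scalerAr (seminormZ qP) mulrA.
  + move=> e f _ _ [n _ <-] [m _ <-].
    exists (q (a ^+ (n + m) * (e * f)) / q a ^+ (n + m)); first by exists (n + m)%N.
    rewrite mulf_div -exprD ler_pM2r ?invr_gt0// exprD mulrACA; exact: (seminormM qP).
have Sq e : inf (S e) = q e.
  apply: (qmin SP) => // [a'|k].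
    by apply: ge_inf => //; exists 0%N => //; rewrite !expr0 mul1r divr1.
  apply: lb_le_inf; first by exists (q (a ^+ 0 * x ^+ k) / q a ^+ 0), 0.
  by move=> _ [n _ <-]; rewrite ler_pdivlMr// mul1r.
apply/eqP; rewrite eq_le (seminormM qP) /=.
rewrite mulrC -ler_pdivlMr// -Sq; apply: ge_inf => //; exists 1 => //.
Qed.

(** The hypothesis of [minimal_seminormM_from] holds first for [a = x], because
    powers of [x] have norm [q x ^+ k >= 1]. Multiplicativity in the factor [x]
    then gives it for every [a]. *)
Theorem minimal_seminormM a b : q (a * b) = q a * q b.
Proof.
have qx1 : 1 <= q x by have := qx 1; rewrite expr1.
have xM e : q (x * e) = q x * q e.
  apply: minimal_seminormM_from => [|n k]; first exact: lt_le_trans ltr01 qx1.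
  have -> : q (x ^+ n * x ^+ k) = q x ^+ n * q x ^+ k.
    rewrite -!exprD; case: (n + k)%N => [|m]; last exact: minimal_seminormX.
    by rewrite !expr0 minimal_seminorm1.
  by rewrite ler_peMr ?exprn_ge0 ?exprn_ege1// (seminorm_ge0 qP).
have xXM k e : q (e * x ^+ k) = q x ^+ k * q e.
  elim: k => [|k IH]; first by rewrite !expr0 mulr1 mul1r.
  by rewrite !exprS mulrCA xM IH mulrA.
have [a0|] := ltP 0 (q a); last first.
  move=> qa; have qa0 : q a = 0 by apply/eqP; rewrite eq_le qa (seminorm_ge0 qP).
  apply/eqP; rewrite qa0 mul0r eq_le (seminorm_ge0 qP) andbT.
  by rewrite (le_trans (seminormM qP _ _))// qa0 mul0r.
apply: minimal_seminormM_from => // n k; rewrite xXM.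
have -> : q (a ^+ n) = q a ^+ n.
  by case: n => [|n]; [rewrite !expr0 minimal_seminorm1|exact: minimal_seminormX].
by rewrite ler_peMl ?exprn_ge0 ?exprn_ege1// (seminorm_ge0 qP).
Qed.

End MinimalSeminorm.
End AlgebraSeminorm.

(** * Characters below a seminorm *)

Lemma expr1D_le (R : realType) (t : R) n :
  0 <= t <= 1 -> (1 + t) ^+ n <= 1 + 3 ^+ n * t.
Proof.
move=> /andP[t0 t1]; elim: n => [|n IH]; first by rewrite !expr0 mul1r lerDl.
rewrite exprS (le_trans (ler_wpM2l _ IH)) ?addr_ge0//.
have : 1 <= (3 : R) ^+ n by rewrite exprn_ege1// ler1n.
rewrite [3 ^+ n.+1]exprS; move: (3 ^+ n) => M M1.
have : M * t * t <= M * t by rewrite ler_piMr// mulr_ge0// (le_trans ler01).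
have : t <= M * t by rewrite ler_peMl.
lra.
Qed.

Section GelfandMazur.
Variables (R : realType) (E : comAlgType R[i]) (q : E -> R).
Hypotheses (qP : algebra_seminorm q) (q1 : q 1 = 1).
Hypothesis qM : forall a b, q (a * b) = q a * q b.
Implicit Types (a b : E) (c l : R[i]).

Lemma mult_seminormX a n : q (a ^+ n) = q a ^+ n.
Proof. by elim: n => [|n IH]; rewrite ?expr0// !exprS qM IH. Qed.

Lemma mult_seminorm_scalar c : q c%:A = cmod c.
Proof. by rewrite (seminormZ qP) q1 mulr1. Qed.

Lemma mult_seminorm_prod (s : seq R[i]) b :
  q (\prod_(z <- s) (b - z%:A)) = \prod_(z <- s) q (b - z%:A).
Proof. by elim/big_rec2: _ => // i x y _ <-; rewrite qM. Qed.

(** The polynomial ['X^(n.+1) - c ^+ n.+1] splits with [c] among its roots, and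
    each of the [n] remaining linear factors contributes at least [m]. *)
Lemma mult_seminorm_shift b c m n : 0 <= m -> (forall l, m <= q (b - l%:A)) ->
  q (b - c%:A) * m ^+ n <= q b ^+ n.+1 + cmod c ^+ n.+1.
Proof.
move=> m0 mb.
pose P : {poly R[i]} := 'X^(n.+1) - (c ^+ n.+1)%:P.
have [r Pr] := closed_field_poly_normal P.
rewrite (eqP (monicXnsubC _ _)) // scale1r in Pr.
have cr : c \in r.
  by rewrite -root_prod_XsubC -Pr rootE !hornerE subrr.
have szr : size r = n.+1.
  have := size_XnsubC (c ^+ n.+1) (ltn0Sn n).
  by rewrite -/P Pr size_prod_XsubC => -[].
have fact : b ^+ n.+1 - (c ^+ n.+1)%:A = \prod_(z <- r) (b - z%:A).
  have := congr1 (horner_alg b) Pr.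
  rewrite rmorphB /= rmorphXn /= horner_algX horner_algC => ->.
  rewrite rmorph_prod /=; apply: eq_bigr => z _.
  by rewrite rmorphB /= horner_algX horner_algC.
have -> : cmod c ^+ n.+1 = q (c ^+ n.+1)%:A by rewrite mult_seminorm_scalar cmodX.
rewrite -mult_seminormX (le_trans _ (seminormB qP _ _))// fact mult_seminorm_prod.
rewrite (perm_big _ (perm_to_rem cr)) big_cons; apply: ler_wpM2l.
  exact: seminorm_ge0.
have -> : n = size (rem c r) by rewrite size_rem// szr.
elim: (rem c r) => [|z s IH]; first by rewrite big_nil.
by rewrite big_cons exprS ler_pM// exprn_ge0.
Qed.

(** If [l] nearly minimizes [l |-> q (a - l%:A)] then so does [l + c] for a fixed
    step of half the minimum: in [mult_seminorm_shift] divided by [m ^+ n] the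
    term [cmod c ^+ n.+1] is negligible for large [n], and then the other one is
    as close to [m] as [q (a - l%:A)] is. *)
Lemma mult_seminorm_near_min a m c e : 0 < m -> cmod c = m / 2 ->
  (forall l, m <= q (a - l%:A)) -> 0 < e ->
  exists2 e', 0 < e' <= e &
    forall l, q (a - l%:A) <= m + e' -> q (a - (l + c)%:A) <= m + e.
Proof.
move=> m0 cm ma e0.
have [N /(_ _ (leqnn N)) Ne] :
    exists N, forall n, (N <= n)%N -> m / 2 * 2^-1 ^+ n < e / 2.
  by apply: geometric_small; lra.
(* The choice makes [m * (1 + t) ^+ N.+1 <= m + e / 2] by [expr1D_le]. *)
pose t := Num.min 1 (e / (2 * m * 3 ^+ N.+1)).
have M0 : 0 < (3 : R) ^+ N.+1 by rewrite exprn_gt0.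
have t0 : 0 < t.
  by rewrite lt_min ltr01 /= divr_gt0// !mulr_gt0.
have t1 : t <= 1 by rewrite ge_min lexx.
have tM : 3 ^+ N.+1 * t * m <= e / 2.
  have : t <= e / (2 * m * 3 ^+ N.+1) by rewrite ge_min lexx orbT.
  rewrite ler_pdivlMr ?mulr_gt0//; move: (3 ^+ N.+1) => M; lra.
exists (Num.min e (t * m)).
  by rewrite lt_min e0 mulr_gt0//= ge_min lexx.
move=> l le.
have {}le : q (a - l%:A) <= m * (1 + t).
  rewrite (le_trans le)// mulrDr mulr1 lerD2l mulrC.
  by rewrite ge_min mulrC lexx orbT.
have mal l' : m <= q (a - l%:A - l'%:A) by rewrite -addrA -opprD -scalerDl.
have := mult_seminorm_shift c N (ltW m0) mal.
rewrite -addrA -opprD -scalerDl cm => qshift.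
have mN : 0 < m ^+ N by rewrite exprn_gt0.
rewrite -(ler_pM2r mN) (le_trans qshift)// mulrDl.
have qN : q (a - l%:A) ^+ N.+1 <= m ^+ N * (m * (1 + 3 ^+ N.+1 * t)).
  rewrite (le_trans (lerXn2r _ _ _ le)) ?nnegrE ?(seminorm_ge0 qP)//.
    by rewrite mulr_ge0 ?addr_ge0// ltW.
  rewrite exprMn exprSr -mulrA; apply: ler_wpM2l; first exact: ltW.
  apply: ler_wpM2l; first exact: ltW.
  by apply: expr1D_le; rewrite (ltW t0).
have cN : (m / 2) ^+ N.+1 <= m ^+ N * (e / 2).
  rewrite exprS exprMn mulrCA; apply: ler_wpM2l; first exact: ltW.
  exact: ltW.
apply: le_trans (lerD qN cN) _.
rewrite -mulrDr -mulrDl mulrC; apply: ler_wpM2r; first exact: ltW.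
move: tM; move: (3 ^+ N.+1) => M; lra.
Qed.

Lemma mult_seminorm_walk a m c e k : 0 < m -> cmod c = m / 2 ->
  (forall l, m <= q (a - l%:A)) -> 0 < e ->
  exists2 e', 0 < e' <= e &
    forall l, q (a - l%:A) <= m + e' -> q (a - (l + c *+ k)%:A) <= m + e.
Proof.
move=> m0 cm ma; elim: k e => [|k IH] e e0.
  by exists e; [rewrite e0 lexx|move=> l; rewrite mulr0n addr0].
have [e1 /andP[e10 e1e] near1] := mult_seminorm_near_min m0 cm ma e0.
have [e2 /andP[e20 e2e] near2] := IH _ e10.
exists e2; first by rewrite e20 (le_trans e2e).
by move=> l /near2/near1; rewrite -addrA mulrSr.
Qed.

(** A positive minimum of [l |-> q (a - l%:A)] would propagate in steps of
    half its size and so be approached arbitrarily far from the spectrum,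
    although [q (a - l%:A)] tends to infinity with [l]. *)
Lemma mult_seminorm_inf0 a e : 0 < e -> exists l, q (a - l%:A) < e.
Proof.
move=> e0; pose S : set R := [set q (a - l%:A) | l in setT].
have S0 : S !=set0 by exists (q (a - 0%:A)), 0.
have Slb : has_lbound S by exists 0 => _ [l _ <-]; exact: seminorm_ge0.
pose m := inf S.
have ma l : m <= q (a - l%:A) by apply: ge_inf => //; exists l.
have m_ge0 : 0 <= m by apply: lb_le_inf => // _ [l _ <-]; exact: seminorm_ge0.
have adh d : 0 < d -> exists l, q (a - l%:A) < m + d.
  by move=> d0; have [_ [l _ <-] ld] := inf_adherent d0 (conj S0 Slb); exists l.
move: m_ge0; rewrite le_eqVlt => /predU1P[m0|m0].
  by have [l] := adh _ e0; rewrite -m0 add0r; exists l.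
exfalso; pose c : R[i] := (m / 2)%:C%C.
have cm : cmod c = m / 2 by rewrite cmod_real// divr_ge0// ltW.
(* After [k] steps the triangle inequality between [l] and [l + c *+ k] fails. *)
pose k := Num.bound ((2 * m + 2) / (m / 2)).
have [d /andP[d0 d1] walk] := mult_seminorm_walk k m0 cm ma (@ltr01 R).
have [l /ltW lm] := adh _ d0.
have := walk _ lm; rewrite scalerDl opprD addrA => lk.
have := seminormB qP (a - l%:A) (a - l%:A - (c *+ k)%:A).
have ck : cmod (c *+ k) = m / 2 * k%:R.
  rewrite -[c *+ k]mulr_natr cmodM cm; congr (_ * _).
  by rewrite -(rmorph_nat (real_complex R)) cmod_real.
rewrite opprB addrC subrK mult_seminorm_scalar ck.
have : (2 * m + 2) / (m / 2) < k%:R 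
  by apply: archi_boundP; rewrite divr_ge0 ?addr_ge0 ?mulr_ge0// ltW// divr_gt0.
rewrite ltr_pdivrMr ?divr_gt0//. lra.
Qed.

(** The point [z] is read off the values [q (a - l%:A)], which turn out to be
    the distances from [z] to [l]: its real part is the supremum of
    [Re l - q (a - l%:A)], and similarly for its imaginary part. *)
Lemma mult_seminorm_point a : exists z, q (a - z%:A) = 0.
Proof.
pose sup_of (f : R[i] -> R) := sup [set f l - q (a - l%:A) | l in setT].
have near (f : R[i] -> R) : (forall l l', f l - f l' <= cmod (l - l')) ->
    forall l, - q (a - l%:A) <= sup_of f - f l <= q (a - l%:A).
  move=> fl l.
  have ub : ubound [set f l - q (a - l%:A) | l in setT] (f l + q (a - l%:A)).
    move=> _ [l' _ <-]; have := seminormB qP (a - l%:A) (a - l'%:A).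
    rewrite opprB addrC addrA subrK -scalerBl mult_seminorm_scalar.
    have := fl l' l; rewrite -cmodB; lra.
  have h1 : sup_of f <= f l + q (a - l%:A).
    by apply: ge_sup => //; exists (f 0 - q (a - 0%:A)), 0.
  have h2 : f l - q (a - l%:A) <= sup_of f.
    by apply: ub_le_sup; [exists (f l + q (a - l%:A))|exists l].
  move: h1 h2; lra.
have nearR l : - q (a - l%:A) <= sup_of (@complex.Re R) - complex.Re l <= q (a - l%:A).
  apply: near => {}l l'; apply: le_trans (cmod_ge_Re (l - l')).
  by case: l => ? ?; case: l'.
have nearI l : - q (a - l%:A) <= sup_of (@complex.Im R) - complex.Im l <= q (a - l%:A).
  apply: near => {}l l'; apply: le_trans (cmod_ge_Im (l - l')).
  by case: l => ? ?; case: l'.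
exists (sup_of (@complex.Re R) +i* sup_of (@complex.Im R))%C.
set z := Complex _ _.
apply/eqP; rewrite eq_le (seminorm_ge0 qP) andbT; apply/ler_addgt0Pr => e e0.
have [l le] : exists l, q (a - l%:A) < e / 3.
  by apply: mult_seminorm_inf0; rewrite divr_gt0.
have := seminormD qP (a - l%:A) (l - z)%:A.
rewrite scalerBl addrA subrK -scalerBl mult_seminorm_scalar cmodB.
have : cmod (z - l) <= 2 * (e / 3).
  move: (nearR l) (nearI l); rewrite /z; case: l le => lx ly /= le nR nI.
  apply: cmod_le_ReIm; [move: nR|move: nI]; lra.
lra.
Qed.

End GelfandMazur.

(** Gelfand theory without completeness: [p] need not be a norm, and the
    characters obtained are bounded by [p]. *)
Theorem exists_character (R : realType) (E : comAlgType R[i]) (p : E -> R) (x : E) :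
  algebra_seminorm p -> (forall n, 1 <= p (x ^+ n)) ->
  exists chi : E -> R[i],
    [/\ forall a b, chi (a + b) = chi a + chi b,
        forall c a, chi (c *: a) = c * chi a,
        forall a b, chi (a * b) = chi a * chi b,
        forall a, cmod (chi a) <= p a & 1 <= cmod (chi x)].
Proof.
move=> pP px.
have [q [qP qp qx qmin]] := minimal_seminorm pP px.
have qM := minimal_seminormM qP qx qmin.
have q1 := minimal_seminorm1 qP qx qmin.
have [chi chiP] := choice (mult_seminorm_point qP q1 qM).
have uniq a l : q (a - l%:A) = 0 -> chi a = l.
  move=> al; apply/eqP; rewrite -subr_eq0; apply/eqP/cmod_eq0.
  rewrite -(mult_seminorm_scalar qP q1); apply/eqP.
  rewrite eq_le (seminorm_ge0 qP) andbT.
  have := seminormB qP (a - l%:A) (a - (chi a)%:A).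
  by rewrite al chiP addr0 opprB addrC addrA subrK -scalerBl.
have qchi a : q a = cmod (chi a).
  by rewrite -(mult_seminorm_scalar qP q1); exact: seminorm_eq.
exists chi; split=> [a b|c a|a b|a|].
- apply: uniq; apply/eqP; rewrite eq_le (seminorm_ge0 qP) andbT.
  have := seminormD qP (a - (chi a)%:A) (b - (chi b)%:A).
  by rewrite !chiP addr0 addrACA -opprD -scalerDl.
- apply: uniq; rewrite -scalerA -scalerBr (seminormZ qP) chiP mulr0 //.
- apply: uniq; apply/eqP; rewrite eq_le (seminorm_ge0 qP) andbT.
  have -> : a * b - (chi a * chi b)%:A =
      (a - (chi a)%:A) * b + chi a *: (b - (chi b)%:A).
    by rewrite mulrBl -scalerAl mul1r scalerBr scalerA addrA subrK.
  rewrite (le_trans (seminormD qP _ _))// qM (seminormZ qP) !chiP.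
  by rewrite mul0r mulr0 addr0.
- by rewrite -qchi.
- by rewrite -qchi; have := qx 1; rewrite expr1.
Qed.

(** * The unitization of a commutative algebra *)

Section NonUnitalTheory.
Variables (K : numFieldType) (A : nuAlgType K).
Implicit Types a b : A.

Lemma amul0l a : amul 0 a = 0.
Proof. by rewrite -{1}(scale0r (0 : A)) amulZl scale0r. Qed.

Lemma amul0r a : amul a 0 = 0.
Proof. by rewrite -{1}(scale0r (0 : A)) amulZr scale0r. Qed.

Lemma amulNl a b : amul (- a) b = - amul a b.
Proof. by rewrite -scaleN1r amulZl scaleN1r. Qed.

Lemma amulBl a b c : amul (a - b) c = amul a c - amul b c.
Proof. by rewrite amulDl amulNl. Qed.

End NonUnitalTheory.

Section Unitization.
Variables (K : numFieldType) (A : nuAlgType K) (mulC : commutative (@amul K A)).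

(** Commutativity is an argument so that the instances below can depend on it. *)
Definition unitization of commutative (@amul K A) : Type := (K^o * A)%type.

Local Notation E := (unitization mulC).

HB.instance Definition _ := GRing.Lmodule.copy E (K^o * A)%type.

Definition umul (u v : E) : E :=
  (u.1 * v.1, u.1 *: v.2 + v.1 *: u.2 + amul u.2 v.2).

Fact umulA : associative umul.
Proof.
move=> [c a] [d b] [e f]; rewrite /umul /=; congr pair; first exact: mulrA.
rewrite !scalerDr !amulDl !amulDr !amulZl !amulZr !scalerA amulA.
rewrite -!addrA [c * e]mulrC [d * e]mulrC; congr (_ + (_ + _)).
by rewrite addrCA; congr (_ + _); rewrite [RHS]addrCA; congr (_ + _); rewrite addrCA.
Qed.

Fact umulC : commutative umul.
Proof.
move=> [c a] [d b]; rewrite /umul /= mulrC mulC; congr pair.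
by rewrite [c *: _ + _]addrC.
Qed.

Fact umul1 : left_id ((1, 0) : E) umul.
Proof.
move=> [c a]; rewrite /umul /=; congr pair; first exact: mul1r.
by rewrite scale1r scaler0 amul0l !addr0.
Qed.

Fact umulDl : left_distributive umul +%R.
Proof.
move=> [c a] [d b] [e f]; rewrite /umul /=; congr pair; first exact: mulrDl.
rewrite scalerDl scalerDr amulDl -!addrA; congr (_ + _).
by rewrite /= addrCA; congr (_ + _); rewrite [RHS]addrCA; congr (_ + _); rewrite addrCA.
Qed.

Fact uone_neq0 : ((1, 0) : E) != 0.
Proof. by apply/eqP => -[] /eqP; rewrite oner_eq0. Qed.

HB.instance Definition _ := GRing.Zmodule_isComNzRing.Build E
  umulA umulC umul1 umulDl uone_neq0.

Fact uscaleAl (c : K) (u v : E) : c *: (u * v) = (c *: u) * v.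
Proof.
case: u v => [d a] [e b]; congr pair; first exact: mulrA.
rewrite /= !scalerDr !scalerA amulZl; congr (_ + _ + _).
by rewrite mulrC.
Qed.
HB.instance Definition _ := GRing.Lmodule_isLalgebra.Build K E uscaleAl.
HB.instance Definition _ := GRing.Lalgebra_isComAlgebra.Build K E.

End Unitization.

Section UnitizationInclusion.
Variables (K : numFieldType) (A : nuAlgType K) (mulC : commutative (@amul K A)).
Local Notation E := (unitization mulC).
Implicit Types a b : A.

Definition uin a : E := (0, a).

Lemma uinD a b : uin (a + b) = uin a + uin b.
Proof. by congr pair; rewrite addr0. Qed.

Lemma uinN a : uin (- a) = - uin a.
Proof. by congr pair; rewrite oppr0. Qed.

Lemma uinB a b : uin (a - b) = uin a - uin b.
Proof. by rewrite uinD uinN. Qed.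

Lemma uinZ c a : uin (c *: a) = c *: uin a.
Proof. by congr pair; rewrite scaler0. Qed.

Lemma uinM a b : uin (amul a b) = uin a * uin b.
Proof. by congr pair; rewrite /= ?mulr0// !scale0r !add0r. Qed.

Lemma uin_inj : injective uin.
Proof. by move=> a b []. Qed.

Lemma uin_ideal (e : E) a : e * uin a = uin (e * uin a).2.
Proof. by congr pair; rewrite /= mulr0. Qed.

Lemma uinX a n : exists b, uin a ^+ n.+1 = uin b.
Proof. by exists (uin a ^+ n * uin a).2; rewrite exprSr uin_ideal. Qed.

(** Quasi-inverses of [a] correspond to inverses of [1 - a]: an inverse has
    scalar component one. *)
Lemma quasi_invertibleP a :
  quasi_invertible a <-> exists e : E, (1 - uin a) * e = 1.
Proof.
have qE b : (1 - uin a) * (1 - uin b) = 1 - uin (a + b - amul a b).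
  by rewrite uinB uinD uinM; ring.
split=> [[b [ab _]]|[e ae]].
  by exists (1 - uin b); rewrite qE ab subr0.
have e1 : e.1 = 1.
  by have := congr1 fst ae; rewrite /= oppr0 addr0 mul1r.
have eE : e = 1 - uin (- e.2).
  by rewrite uinN opprK; case: e e1 {ae} => c b /= ->; congr pair; rewrite ?addr0 ?add0r.
move: ae; rewrite eE qE => /(congr1 snd) /= /eqP.
rewrite add0r oppr_eq0 => /eqP ae; exists (- e.2).
by split; [|rewrite [amul (- e.2) a]mulC].
Qed.

End UnitizationInclusion.

Section RealNorm.
Variables (R : realType) (A : nuAlgType R[i]) (nu : algebra_norm A).
Implicit Types a b : A.

(** [nu a] is a nonnegative real of [R[i]]. *)
Definition rnorm a : R := complex.Re (nu a).

Lemma anorm0 : nu 0 = 0.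
Proof. by rewrite -(scale0r 0) anormZ normr0 mul0r. Qed.

Lemma anormN a : nu (- a) = nu a.
Proof. by rewrite -scaleN1r anormZ normrN normr1 mul1r. Qed.

Lemma rnormE a : nu a = (rnorm a)%:C%C.
Proof.
suff /ger0_Im im0 : 0 <= nu a by rewrite /rnorm; case: (nu a) im0 => x y /= ->.
have := ler_anormD nu a (- a).
by rewrite subrr anorm0 anormN -mulr2n pmulrn_lge0.
Qed.

Lemma rnormD a b : rnorm (a + b) <= rnorm a + rnorm b.
Proof. by rewrite -lecR rmorphD /= -!rnormE ler_anormD. Qed.

Lemma rnormM a b : rnorm (amul a b) <= rnorm a * rnorm b.
Proof. by rewrite -lecR rmorphM /= -!rnormE ler_anormM. Qed.

Lemma rnormZ c a : rnorm (c *: a) = cmod c * rnorm a.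
Proof. by apply: (@complexI R); rewrite rmorphM /= -!rnormE anormZ cmodE. Qed.

Lemma rnorm0 : rnorm 0 = 0.
Proof. by rewrite /rnorm anorm0. Qed.

Lemma rnormN a : rnorm (- a) = rnorm a.
Proof. by rewrite /rnorm anormN. Qed.

Lemma rnormB a b : rnorm (a - b) <= rnorm a + rnorm b.
Proof. by rewrite -(rnormN b) rnormD. Qed.

Lemma rnorm_ge0 a : 0 <= rnorm a.
Proof. by have := rnormB a a; rewrite subrr rnorm0 -mulr2n pmulrn_lge0. Qed.

Lemma rnorm_eq0 a : rnorm a = 0 -> a = 0.
Proof. by move=> a0; apply: (@anorm0_eq0 _ _ nu); rewrite rnormE a0. Qed.

Lemma rnorm_gt0 a : a != 0 -> 0 < rnorm a.
Proof.
move=> a0; rewrite lt_neqAle rnorm_ge0 andbT eq_sym.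
by apply: contra_neq a0; exact: rnorm_eq0.
Qed.

Lemma rnorm_le_small_eq0 a : (forall e, 0 < e -> rnorm a <= e) -> a = 0.
Proof.
move=> ae; apply: rnorm_eq0; apply/eqP; rewrite eq_le rnorm_ge0 andbT.
by apply/ler_addgt0Pr => e /ae; rewrite add0r.
Qed.

Lemma rnorm_sum I (r : seq I) (P : pred I) (F : I -> A) :
  rnorm (\sum_(i <- r | P i) F i) <= \sum_(i <- r | P i) rnorm (F i).
Proof.
elim/big_rec2: _ => [|i s a _ sa]; first by rewrite rnorm0.
by rewrite (le_trans (rnormD _ _))// lerD2l.
Qed.

End RealNorm.

Section MultiplicativeFunctional.
Variables (R : realType) (A : nuAlgType R[i]).
Implicit Types a b : A.

Definition multiplicative_functional (psi : A -> R[i]) :=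
  [/\ forall a b, psi (a + b) = psi a + psi b,
      forall c a, psi (c *: a) = c * psi a &
      forall a b, psi (amul a b) = psi a * psi b].

Lemma multiplicative_functionalB (psi : A -> R[i]) a b :
  multiplicative_functional psi -> psi (a - b) = psi a - psi b.
Proof. by case=> psiD psiZ _; rewrite psiD -scaleN1r psiZ mulN1r. Qed.

End MultiplicativeFunctional.

Section QuotientSeminorm.
Variables (R : realType) (A : nuAlgType R[i]) (mulC : commutative (@amul R[i] A)).
Variables (nu : algebra_norm A) (J : set A) (Jid : left_ideal J).
Local Notation E := (unitization mulC).
Local Notation uin := (uin mulC).
Implicit Types a b : A.

(** The distance to [J] in the unitization normed by [cmod c + nu a]; on [A] it
    is the quotient seminorm of [nu] by [J]. *)
Definition quotient_seminorm (e : E) : R :=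
  inf [set cmod e.1 + rnorm nu (e.2 - j) | j in J].

Lemma idealD a b : J a -> J b -> J (a + b).
Proof. by case: Jid => _ JD _ Ja Jb; rewrite -[a]scale1r; exact: JD. Qed.

Lemma idealZ c a : J a -> J (c *: a).
Proof. by case: Jid => J0 JD _ Ja; rewrite -[_ *: _]addr0; exact: JD. Qed.

Lemma idealM a b : J b -> J (amul a b).
Proof. by case: Jid => _ _; apply. Qed.

Lemma ideal_uin (e : E) j : J j -> exists2 k, J k & e * uin j = uin k.
Proof.
move=> Jj; exists (e * uin j).2; last exact: uin_ideal.
by rewrite /= scale0r addr0; apply: idealD; [exact: idealZ|exact: idealM].
Qed.

Let N (e : E) : R := cmod e.1 + rnorm nu e.2.

Let NM e f : N (e * f) <= N e * N f.
Proof.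
rewrite /N /= cmodM.
have := rnormD nu (e.1 *: f.2 + f.1 *: e.2) (amul e.2 f.2).
have := rnormD nu (e.1 *: f.2) (f.1 *: e.2).
have := rnormM nu e.2 f.2.
rewrite !rnormZ; lra.
Qed.

Lemma quotient_seminormE e :
  quotient_seminorm e = inf [set N (e - uin j) | j in J].
Proof.
congr (inf _); apply/seteqP; split=> _ [j Jj <-]; exists j => //;
by rewrite /N /= subr0.
Qed.

Lemma quotient_seminormP : algebra_seminorm quotient_seminorm.
Proof.
rewrite (_ : quotient_seminorm = fun e => inf [set N (e - uin j) | j in J]); last first.
  by apply/funext => e; exact: quotient_seminormE.
have J0 : J 0 by case: Jid.
apply: inf_seminorm => [e|e _ [j _ <-]|e f _ _ [j Jj <-] [k Jk <-]|c e _ [j Jj <-]|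
    e f _ _ [j Jj <-] [k Jk <-]].
- by exists (N (e - uin 0)), 0.
- by rewrite addr_ge0 ?cmod_ge0 ?rnorm_ge0.
- exists (N (e + f - uin (j + k))); first by exists (j + k) => //; exact: idealD.
  rewrite uinD opprD addrACA /N /=.
  have := rnormD nu (e - uin j).2 (f - uin k).2.
  have := cmodD (e - uin j).1 (f - uin k).1.
  rewrite /=; lra.
- exists (N (c *: e - uin (c *: j))); first by exists (c *: j) => //; exact: idealZ.
  by rewrite uinZ -scalerBr /N /= rnormZ [cmod (_ *: _)]cmodM mulrDr.
- have [k' Jk' kE] := ideal_uin e Jk; have [j' Jj' jE] := ideal_uin (f - uin k) Jj.
  exists (N (e * f - uin (k' + j'))); first by exists (k' + j') => //; exact: idealD.
  have -> : e * f - uin (k' + j') = (e - uin j) * (f - uin k).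
    rewrite uinD -kE -jE; ring.
  exact: NM.
Qed.

Lemma quotient_seminorm_le a j : J j -> quotient_seminorm (uin a) <= rnorm nu (a - j).
Proof.
move=> Jj; apply: ge_inf; last by exists j => //; rewrite /= cmod0 add0r.
by exists 0 => _ [k _ <-]; rewrite addr_ge0 ?cmod_ge0 ?rnorm_ge0.
Qed.

Lemma le_quotient_seminorm a s :
  (forall j, J j -> s <= rnorm nu (a - j)) -> s <= quotient_seminorm (uin a).
Proof.
move=> sa; have J0 : J 0 by case: Jid.
apply: lb_le_inf; first by exists (cmod (uin a).1 + rnorm nu (a - 0)), 0.
by move=> _ [j /sa sj <-]; rewrite /= cmod0 add0r.
Qed.

Lemma quotient_seminorm_lt a s : quotient_seminorm (uin a) < s ->
  exists2 j, J j & rnorm nu (a - j) < s.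
Proof.
move=> sa; apply: contrapT => nj; move: sa; rewrite ltNge => /negP; apply.
apply: le_quotient_seminorm => j Jj; rewrite leNgt; apply/negP => js.
by apply: nj; exists j.
Qed.

(** Being bounded by the quotient seminorm forces the character to vanish on [J]
    and to be bounded by [nu]; its value at [y] keeps it nonzero on [A]. *)
Lemma exists_character_mod_ideal y :
  (forall n, 1 <= quotient_seminorm (uin y ^+ n.+1)) ->
  exists psi, [/\ multiplicative_functional psi, forall a, cmod (psi a) <= rnorm nu a,
    forall j, J j -> psi j = 0 & 1 <= cmod (psi y)].
Proof.
move=> yn; have qP := quotient_seminormP.
have y1 : 1 <= quotient_seminorm (uin y) by have := yn 0; rewrite expr1.
have [|chi [chiD chiZ chiM chile chiy]] := exists_character (x := uin y) qP.
  by case=> //; rewrite expr0; exact: seminorm1_ge1 y1.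
exists (fun a => chi (uin a)); split=> [|a|j Jj|//].
- by split=> *; rewrite ?uinD ?uinZ ?uinM.
- rewrite (le_trans (chile _))//; rewrite -{2}[a]subr0.
  by apply: quotient_seminorm_le; case: Jid.
- apply: cmod_eq0; apply/eqP; rewrite eq_le cmod_ge0 andbT (le_trans (chile _))//.
  by rewrite (le_trans (quotient_seminorm_le _ Jj))// subrr rnorm0.
Qed.

End QuotientSeminorm.

(** * Commutative Banach algebras *)

Section Banach.
Variables (R : realType) (A : banachAlgType R[i]).
Hypothesis mulC : commutative (@amul R[i] A).
Local Notation E := (unitization mulC).
Local Notation uin := (uin mulC).
Implicit Types a b : A.

Definition banach_norm : algebra_norm A := @AlgebraNorm R[i] A (fun a => `|a|)
  (@ler_normD _ A) (@normrZ _ A) (@normr0_eq0 _ A) (@ler_normAM _ A).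

Local Notation N := (rnorm banach_norm).

Lemma banach_normE a : `|a| = (N a)%:C%C.
Proof. exact: (rnormE banach_norm). Qed.

Lemma banach_series (d : nat -> A) (C r : R) : 0 <= r < 1 ->
  (forall k, N (d k) <= C * r ^+ k) ->
  exists y, forall e, 0 < e -> exists M, forall n, (M <= n)%N ->
    N (y - \sum_(0 <= k < n) d k) <= e.
Proof.
move=> r01 dC.
have C0 : 0 <= C by have := dC 0%N; rewrite expr0 mulr1; exact: le_trans (rnorm_ge0 _ _).
have : cvg (series d @ \oo).
  apply/cauchy_cvgP/cauchy_seriesP => e e0.
  have e0' : 0 < complex.Re e by move: e0; rewrite ltcE => /andP[].
  have eE : e = (complex.Re e)%:C%C by rewrite RRe_real// gtr0_real.
  have [M Mr] := geometric_small (C / (1 - r)) r01 e0'.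
  exists ([set n | (M <= n)%N], setT).
    by split; [exists M|exact: filterT].
  move=> [m n] [/= Mm _]; rewrite banach_normE eE ltcR.
  apply: le_lt_trans (Mr _ Mm); apply: le_trans (geometric_tail m n C0 r01).
  by apply: le_trans (rnorm_sum _ _ _ _) _; apply: ler_sum.
move=> /cvg_ex[y /cvgrPdist_le dy]; exists y => e e0.
have e0' : 0 < e%:C%C by rewrite ltcR.
have [M _ Me] := dy _ e0'; exists M => n /Me /=.
by rewrite banach_normE lecR.
Qed.

(** The sum [y] of the Neumann series of the powers [a ^+ k.+1] satisfies
    [(1 - a) * (1 + y) = 1]. *)
Lemma one_sub_small_inverse a : N a < 1 -> exists e : E, (1 - uin a) * e = 1.
Proof.
move=> a1; pose d k := (uin a ^+ k.+1).2.
have dE k : uin (d k) = uin a ^+ k.+1.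
  by have [b bE] := uinX mulC a k; rewrite /d bE.
have dN k : N (d k) <= N a * N a ^+ k.
  rewrite -exprS; elim: k => [|k IH]; first by rewrite /d expr1.
  have -> : d k.+1 = amul a (d k).
    by apply: (@uin_inj _ _ mulC); rewrite uinM !dE -exprS.
  by rewrite (le_trans (rnormM _ _ _))// [leRHS]exprS ler_wpM2l ?rnorm_ge0.
have [|y yd] := banach_series _ dN; first by rewrite rnorm_ge0.
have sumE n : (1 - uin a) * (1 + uin (\sum_(0 <= k < n) d k)) = 1 - uin a ^+ n.+1.
  elim: n => [|n IH].
    rewrite big_geq// expr1 (_ : uin 0 = 0)// addr0 mulr1 //.
  rewrite big_nat_recr//= uinD addrA mulrDr IH dE [uin a ^+ n.+2]exprS.
  by ring.
exists (1 + uin y); apply/eqP; rewrite -subr_eq0; apply/eqP.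
have -> : (1 - uin a) * (1 + uin y) - 1 = uin (y - amul a y - a).
  by rewrite !uinB uinM; ring.
congr uin; apply: (rnorm_le_small_eq0 (nu := banach_norm)) => e e0.
have e4 : 0 < e / 4 by rewrite divr_gt0.
have [M1 yM] := yd _ e4.
have [|M2 aM] := @geometric_small _ 1 (N a) _ _ e4; first by rewrite rnorm_ge0.
pose n := maxn M1 M2.
pose s := \sum_(0 <= k < n) d k.
have -> : y - amul a y - a = (y - s) - amul a (y - s) - d n.
  apply: (@uin_inj _ _ mulC); have := sumE n; rewrite -/s !uinB !uinM !uinB dE => sE.
  have -> : uin a ^+ n.+1 = 1 - (1 - uin a) * (1 + uin s) by rewrite sE; ring.
  ring.
have h1 := yM n (leq_maxl _ _); have h2 := aM n (leq_maxr _ _).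
have := rnormB banach_norm (y - s - amul a (y - s)) (d n).
have := rnormB banach_norm (y - s) (amul a (y - s)).
have := rnormM banach_norm a (y - s).
have : N a * N (y - s) <= N (y - s) by rewrite ler_piMl ?rnorm_ge0// ltW.
have := dN n; rewrite -/s in h1.
have : N a * N a ^+ n <= N a ^+ n by rewrite ler_piMl ?exprn_ge0 ?rnorm_ge0// ltW.
lra.
Qed.

Lemma left_ideal0 : left_ideal ([set 0] : set A).
Proof.
split=> //= [c x y -> ->|c x ->]; first by rewrite scaler0 addr0.
exact: amul0r.
Qed.

Lemma one_sub_inverse_of_power a n b : uin a ^+ n.+1 = uin b -> N b < 1 ->
  exists e : E, (1 - uin a) * e = 1.
Proof.
move=> ab /one_sub_small_inverse[e]; rewrite -ab => be.
exists ((\sum_(i < n.+1) uin a ^+ i) * e); rewrite mulrA -[RHS]be; congr (_ * _).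
have := subrXX 1 (uin a) n.+1; rewrite expr1n => ->; congr (_ * _).
by apply: eq_bigr => i _; rewrite expr1n mul1r.
Qed.

(** Multiplicative functionals on a Banach algebra are automatically
    contractive: otherwise some [a] with [N a < 1] would be mapped to [1],
    while [1 - a] is invertible. *)
Lemma multiplicative_functional_le psi a :
  multiplicative_functional psi -> cmod (psi a) <= N a.
Proof.
move=> psiP; have [psiD psiZ psiM] := psiP.
rewrite leNgt; apply/negP => ap.
have p0 : psi a != 0.
  by rewrite -cmod_gt0; apply: le_lt_trans ap; exact: rnorm_ge0.
pose b := (psi a)^-1 *: a.
have b1 : psi b = 1 by rewrite psiZ mulVf.
have /one_sub_small_inverse/quasi_invertibleP[z [bz _]] : N b < 1.
  by rewrite rnormZ cmodV mulrC ltr_pdivrMr ?mul1r ?cmod_gt0.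
have := congr1 psi bz; rewrite multiplicative_functionalB// psiD psiM b1 mul1r.
have -> : psi 0 = 0 by rewrite -(subrr b) multiplicative_functionalB// subrr.
by rewrite addrK => /eqP; rewrite oner_eq0.
Qed.

Lemma character_multiplicative (g : A -> R[i]) :
  is_character g -> multiplicative_functional g.
Proof.
move=> [gl gM _ _].
have gD a b : g (a + b) = g a + g b by have := gl 1 a b; rewrite !scale1r.
have g0 : g 0 = 0 by apply: (addIr (g 0)); rewrite -gD !add0r.
split=> // c a; have := gl c a 0; by rewrite !addr0 g0 addr0.
Qed.

Lemma multiplicative_functional_spectrum (psi : A -> R[i]) x :
  multiplicative_functional psi -> psi x != 0 ->
  exists f : spectrum A, forall a, gelfand a f = psi a.
Proof.
move=> psiP px; have [psiD psiZ psiM] := psiP.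
have psic : is_character (psi : A -> R[i]^o).
  split => //; [by move=> c a b; rewrite psiD psiZ| |by exists x].
  move=> a; apply/cvgrPdist_lt => e e0; near=> b.
  rewrite -multiplicative_functionalB//.
  apply: (@le_lt_trans _ _ `|a - b|).
    by rewrite banach_normE cmodE lecR; exact: multiplicative_functional_le.
  near: b; exact: cvgr_dist_lt.
by exists (SigSub (mem_set psic : (psi : {ptws A -> R[i]^o}) \in spectrum A)).
Unshelve. all: by end_near. Qed.

Lemma gelfand_multiplicative (f : spectrum A) :
  multiplicative_functional (fun a => gelfand a f).
Proof. by case: f => g gP; apply: character_multiplicative; exact: set_mem gP. Qed.

(** If every power of [a] has norm at least one there is a character by
    [exists_character]; if one is smaller, [1 - a] divides an invertible element. *)
Lemma nonunit_character a : ~ quasi_invertible a ->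
  exists2 psi, multiplicative_functional psi & 1 <= cmod (psi a).
Proof.
move=> aq; have [|psi [psiP _ _ psia]] :=
    @exists_character_mod_ideal _ _ mulC banach_norm _ left_ideal0 a.
  move=> n; have [b bE] := uinX mulC a n; rewrite bE leNgt; apply/negP.
  move=> /(quotient_seminorm_lt left_ideal0)[_ -> b1]; rewrite subr0 in b1.
  by apply: aq; apply/(quasi_invertibleP mulC); exact: one_sub_inverse_of_power bE b1.
by exists psi.
Qed.

(** If [b] is outside a maximal modular left ideal [I] with modular unit [e],
    then [e = i + b'] with [i] in [I] and [b'] a multiple of [b]. All characters
    vanish at [b'], so [1 - b'] is invertible, whereas multiplication by [1 - b']
    sends [A] into [I]; this would make [I] the whole algebra. *)
Lemma semisimple_separates b : semisimple A ->
  (forall psi, multiplicative_functional psi -> psi b = 0) -> b = 0.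
Proof.
move=> ss pb; suff : jacobson_radical A b by rewrite ss.
move=> I [Iid [e Ie] Iprop Imax]; apply: contrapT => Ib.
pose J : set A := [set x | exists2 i, I i & exists c a, x = i + c *: b + amul a b].
have Jid : left_ideal J.
  split=> [|c x y [i Ii [d [a ->]]] [j Ij [d' [a' ->]]]|x _ [i Ii [d [a ->]]]].
  - exists 0; first by case: Iid.
    by exists 0, 0; rewrite scale0r amul0l !addr0.
  - exists (c *: i + j); first by case: Iid => _ ID _; exact: ID.
    exists (c * d + d'), (c *: a + a').
    rewrite !scalerDr !scalerDl amulDl amulZl scalerA addrACA; congr (_ + _).
    by rewrite addrACA.
  - exists (amul x i); first exact: idealM.
    exists 0, (d *: x + amul x a).
    by rewrite scale0r addr0 !amulDr amulDl amulZl amulZr amulA addrA.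
have IJ : I `<=` J.
  by move=> i Ii; exists i => //; exists 0, 0; rewrite scale0r amul0l !addr0.
have [JI|JT] := Imax _ Jid IJ.
  apply: Ib; rewrite -JI; exists 0; first by case: Iid.
  by exists 1, 0; rewrite scale1r amul0l add0r addr0.
have [i Ii [c [a eE]]] : J e by rewrite JT.
pose b' := c *: b + amul a b.
have b'0 psi : multiplicative_functional psi -> psi b' = 0.
  move=> psiP; have [psiD psiZ psiM] := psiP.
  by rewrite psiD psiZ psiM pb// !mulr0 addr0.
have [w [bw _]] : quasi_invertible b'.
  apply: contrapT => /nonunit_character[psi psiP].
  by rewrite b'0// cmod0 ler10.
move/eqP: Iprop; apply; apply/seteqP; split=> // x _.
have Ib' y : I (y - amul y b').
  have -> : y - amul y b' = (y - amul y e) + amul y i.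
    have -> : e = i + b' by rewrite addrA.
    by apply: (@uin_inj _ _ mulC); rewrite !(uinB, uinM, uinD); ring.
  by apply: idealD => //; exact: idealM.
have := Ib' (x - amul x w).
have -> : x - amul x w - amul (x - amul x w) b' = x - amul x (b' + w - amul b' w).
  apply: (@uin_inj _ _ mulC); rewrite !(uinB, uinM, uinD); ring.
by rewrite bw amul0r subr0.
Qed.

End Banach.

(** * Local units *)

(** The Newton iteration [e -> 3 e ^ 2 - 2 e ^ 3] for idempotents: the defect
    [e - e ^ 2] converges to [0] quadratically, and the increment is the product of
    the defect with [2 e - 1]. *)

Section NewtonRing.
Variables (E : comNzRingType) (e : nat -> E).
Hypothesis eS : forall k, e k.+1 = e k ^+ 2 *+ 3 - e k ^+ 3 *+ 2.

Lemma newton_increment k : e k.+1 - e k = (e k - e k ^+ 2) * (e k *+ 2 - 1).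
Proof. by rewrite eS; ring. Qed.

Lemma newton_defect k : e k.+1 - e k.+1 ^+ 2 =
  (e k - e k ^+ 2) * (e k - e k ^+ 2) * (3%:R + (e k - e k ^+ 2) *+ 4).
Proof. by rewrite eS; ring. Qed.

Lemma newton_sign k : e k.+1 *+ 2 - 1 =
  (1 + (e k - e k ^+ 2) *+ 2) * (e k *+ 2 - 1).
Proof. by rewrite eS; ring. Qed.

Lemma newton_near1 k : e k.+1 - 1 = - ((e k - 1) ^+ 2 * (3%:R + (e k - 1) *+ 2)).
Proof. by rewrite eS; ring. Qed.

End NewtonRing.

Lemma newton_cvg1 (R : realType) (t : nat -> R[i]) :
  (forall k, t k.+1 = t k ^+ 2 *+ 3 - t k ^+ 3 *+ 2) -> cmod (t 0%N - 1) <= 1 / 32 ->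
  forall k, cmod (t k - 1) <= 1 / 32 * 2^-1 ^+ k.
Proof.
move=> tS t0; elim=> [|k IH]; first by rewrite expr0 mulr1.
rewrite (newton_near1 tS) cmodN cmodM cmodX.
set d := t k - 1 in IH *.
have c3 : cmod (3%:R : R[i]) = 3.
  by rewrite -(rmorph_nat (real_complex R)) cmod_real.
have c2 : cmod (d *+ 2) = cmod d * 2.
  by rewrite -[d *+ 2]mulr_natr cmodM -(rmorph_nat (real_complex R)) cmod_real.
have := cmodD 3%:R (d *+ 2); rewrite c3 c2.
have := cmod_ge0 d; have := cmod_ge0 (3%:R + d *+ 2).
have : (2^-1 : R) ^+ k <= 1 by rewrite exprn_ile1//; lra.
rewrite [2^-1 ^+ k.+1]exprS; move: IH.
move: (2^-1 ^+ k) (cmod d) (cmod (_ + _)) => h u v IH h1 v0 u0 vu.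
have u32 : u <= 1 / 32 by lra.
have : u * v <= 1 / 2 by nra.
rewrite expr2; nra.
Qed.

Section NewtonSeminorm.
Variables (R : realType) (E : comAlgType R[i]) (q : E -> R).
Hypothesis qP : algebra_seminorm q.
Variables (e : nat -> E).
Hypothesis eS : forall k, e k.+1 = e k ^+ 2 *+ 3 - e k ^+ 3 *+ 2.
Implicit Types (a b : E).

Local Notation z := (e 0%N - e 0%N ^+ 2).
Local Notation s := (16^-1 : R).
Variable n : nat.
Hypothesis zn : q (z ^+ n.+1) <= s ^+ n.+1.

(** An equivalent seminorm for which multiplication by [z] is a contraction of
    ratio [s], although [q z] itself may be large. *)
Definition contracting_seminorm a := \sum_(i < n.+1) q (z ^+ i * a) / s ^+ i.
Local Notation p := contracting_seminorm.

(** Operator bounds multiply, whereas [contracting_seminorm] itself is not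
    submultiplicative. *)
Definition mult_bound a (r : R) := 0 <= r /\ forall b, p (a * b) <= r * p b.

Let s0 i : 0 < s ^+ i. Proof. by rewrite exprn_gt0//; lra. Qed.

Let pge0 a : 0 <= p a.
Proof. by apply: sumr_ge0 => i _; rewrite divr_ge0 ?(ltW (s0 _))// (seminorm_ge0 qP). Qed.

Let qp a : q a <= p a.
Proof.
rewrite /contracting_seminorm big_ord_recl /= !expr0 mul1r divr1 lerDl.
by apply: sumr_ge0 => i _; rewrite divr_ge0 ?(ltW (s0 _))// (seminorm_ge0 qP).
Qed.

Let pD a b : p (a + b) <= p a + p b.
Proof.
rewrite -big_split; apply: ler_sum => i _ /=.
by rewrite -mulrDl ler_pM2r ?invr_gt0// mulrDr; exact: (seminormD qP).
Qed.

Let pMn a k : p (a *+ k) <= k%:R * p a.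
Proof.
elim: k => [|k IH].
  rewrite mulr0n mul0r /contracting_seminorm big1// => i _.
  by rewrite mulr0 (seminorm0 qP) mul0r.
rewrite mulrS (le_trans (pD _ _))// -[k.+1]add1n natrD mulrDl mul1r.
exact: lerD.
Qed.

Lemma mult_bound_contracting : mult_bound z s.
Proof.
split=> [|b]; first lra.
have s_neq0 : s != 0 by rewrite gt_eqF//; lra.
rewrite /contracting_seminorm mulr_sumr big_ord_recr big_ord_recl /= addrC.
apply: lerD.
  rewrite mulrA -exprSr !expr0 mul1r divr1 ler_pdivrMr// mulrAC -exprS.
  rewrite (le_trans (seminormM qP _ _))//; apply: ler_wpM2r => //.
  exact: seminorm_ge0.
apply: ler_sum => i _.
rewrite mulrA -exprSr /bump /= add1n [s ^+ i.+1]exprS.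
by rewrite invfM mulrCA mulVKf// lexx.
Qed.

Lemma mult_boundM a b r t :
  mult_bound a r -> mult_bound b t -> mult_bound (a * b) (r * t).
Proof.
move=> [r0 ar] [t0 bt]; split=> [|c]; first exact: mulr_ge0.
rewrite -!mulrA (le_trans (ar _))//; apply: ler_wpM2l => //; exact: bt.
Qed.

Lemma mult_boundD a b r t :
  mult_bound a r -> mult_bound b t -> mult_bound (a + b) (r + t).
Proof.
move=> [r0 ar] [t0 bt]; split=> [|c]; first exact: addr_ge0.
by rewrite !mulrDl (le_trans (pD _ _))// lerD.
Qed.

Lemma mult_boundMn a r k : mult_bound a r -> mult_bound (a *+ k) (k%:R * r).
Proof.
move=> [r0 ar]; split=> [|c]; first by rewrite mulr_ge0.
by rewrite [a *+ k * c]mulrnAl (le_trans (pMn _ _))// -mulrA ler_wpM2l.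
Qed.

Lemma mult_bound1 : mult_bound 1 1.
Proof. by split=> // c; rewrite !mul1r. Qed.

Lemma mult_bound_le a r t : r <= t -> mult_bound a r -> mult_bound a t.
Proof.
move=> rt [r0 ar]; split=> [|c]; first exact: le_trans rt.
by rewrite (le_trans (ar c))// ler_wpM2r.
Qed.

Lemma mult_bound_defect k : mult_bound (e k - e k ^+ 2) (s * 4^-1 ^+ k).
Proof.
elim: k => [|k IH]; first by rewrite expr0 mulr1; exact: mult_bound_contracting.
rewrite (newton_defect eS).
apply: mult_bound_le (mult_boundM (mult_boundM IH IH)
  (mult_boundD (mult_boundMn 3 mult_bound1) (mult_boundMn 4 IH))).
have : (4^-1 : R) ^+ k <= 1 by rewrite exprn_ile1//; lra.
have : 0 <= (4^-1 : R) ^+ k by rewrite exprn_ge0//; lra.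
rewrite [4^-1 ^+ k.+1]exprS; move: (4^-1 ^+ k) => h h0 h1.
have : h * h <= h by nra.
have : h * h * h <= h by nra.
lra.
Qed.

Lemma newton_sign_le k : p (e k *+ 2 - 1) <= 2 ^+ k * p (e 0%N *+ 2 - 1).
Proof.
elim: k => [|k IH]; first by rewrite expr0 mul1r.
rewrite (newton_sign eS).
have : mult_bound (1 + (e k - e k ^+ 2) *+ 2) 2.
  apply: mult_bound_le (mult_boundD mult_bound1 (mult_boundMn 2 (mult_bound_defect k))).
  have : (4^-1 : R) ^+ k <= 1 by rewrite exprn_ile1//; lra.
  lra.
by move=> [_ /(_ (e k *+ 2 - 1))/le_trans]; apply; rewrite exprS -mulrA ler_wpM2l.
Qed.

(** The defect is bounded as an operator by [4 ^ - k], while [2 e - 1] grows at most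
    like [2 ^ k]; the product decreases geometrically. *)
Lemma newton_increment_le :
  exists2 C, 0 <= C & forall k, q (e k.+1 - e k) <= C * 2^-1 ^+ k.
Proof.
exists (p (e 0%N *+ 2 - 1)) => // k; rewrite (newton_increment eS).
have [_ /(_ (e k *+ 2 - 1)) zk] := mult_bound_defect k.
apply: le_trans (qp _) _; apply: le_trans zk _.
have h0 : 0 <= (4^-1 : R) ^+ k by rewrite exprn_ge0//; lra.
have s1 : s <= 1 by lra.
have := newton_sign_le k => /(ler_wpM2l h0); rewrite mulrA -exprMn.
have -> : 4^-1 * 2 = 2^-1 :> R by lra.
rewrite [leRHS]mulrC; apply: le_trans; rewrite -mulrA ler_piMl// mulr_ge0//.
Qed.

End NewtonSeminorm.

Section LocalUnit.
Variables (R : realType) (A : banachAlgType R[i]).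
Hypothesis mulC : commutative (@amul R[i] A).
Local Notation E := (unitization mulC).
Local Notation uin := (uin mulC).
Local Notation N := (rnorm (banach_norm A)).
Variable x : A.

Definition near_one (psi : A -> R[i]) :=
  multiplicative_functional psi /\ cmod (psi x - 1) <= 1 / 32.

Definition vanishing_near_one : set A := [set a | forall psi, near_one psi -> psi a = 0].

Local Notation J := vanishing_near_one.

Lemma left_ideal_vanishing_near_one : left_ideal J.
Proof.
split=> [psi [[psiD _ _] _]|c a b Ja Jb psi psi1|a b Jb psi psi1].
- by apply: (addIr (psi 0)); rewrite -psiD !add0r.
- by have [[psiD psiZ _] _] := psi1; rewrite psiD psiZ Ja// Jb// mulr0 addr0.
- by have [[_ _ psiM] _] := psi1; rewrite psiM Jb// mulr0.
Qed.

(** The hull of [J] is the neighbourhood it was defined from; this is where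
    regularity enters. *)
Hypothesis hull : forall psi, multiplicative_functional psi ->
  (exists a, psi a != 0) -> (forall j, J j -> psi j = 0) -> near_one psi.

Local Notation q := (@quotient_seminorm _ _ mulC (banach_norm A) J).
Local Notation z := (x - amul x x).

(** A character that kills [J] satisfies [near_one], so its value at [x - x ^ 2] has
    modulus at most [33 / 32 * 1 / 32 < 1 / 16]. *)
Lemma defect_spectral_radius : exists n, q (uin z ^+ n.+1) <= 16^-1 ^+ n.+1.
Proof.
apply: contrapT => nz; have Jid := left_ideal_vanishing_near_one.
have qP := quotient_seminormP mulC (banach_norm A) Jid.
have c16 k : cmod (16%:R ^+ k : R[i]) = 16 ^+ k.
  by rewrite cmodX -(rmorph_nat (real_complex R)) cmod_real.
have [n|psi [psiP _ psiJ psiz]] :=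
    @exists_character_mod_ideal _ _ mulC (banach_norm A) _ Jid (16%:R *: z).
  rewrite leNgt; apply/negP => zn; apply: nz; exists n.
  move: zn; rewrite uinZ exprZn (seminormZ qP) c16 exprVn.
  by rewrite -ltr_pdivlMl ?exprn_gt0// mulr1 => /ltW.
have [psiD psiZ psiM] := psiP.
have [] := hull psiP _ psiJ.
  by exists (16%:R *: z); rewrite -cmod_gt0 (lt_le_trans ltr01).
move=> _ psix; move: psiz.
rewrite psiZ multiplicative_functionalB// psiM cmodM.
have := c16 1%N; rewrite !expr1 => ->.
have -> : psi x - psi x * psi x = - ((1 + (psi x - 1)) * (psi x - 1)) by ring.
rewrite cmodN cmodM; have := cmodD 1 (psi x - 1); rewrite cmod1.
have := cmod_ge0 (psi x - 1); have := cmod_ge0 (1 + (psi x - 1)).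
move: psix; move: (cmod (psi x - 1)) (cmod (1 + _)) => u v; nra.
Qed.

Fixpoint newton_iter k : A :=
  if k is k'.+1 then let a := newton_iter k' in
    3%:R *: amul a a - 2%:R *: amul a (amul a a)
  else x.

Lemma newton_iterE (psi : A -> R[i]) k : multiplicative_functional psi ->
  psi (newton_iter k.+1) = psi (newton_iter k) ^+ 2 *+ 3 - psi (newton_iter k) ^+ 3 *+ 2.
Proof.
move=> psiP; have [psiD psiZ psiM] := psiP.
by rewrite /= multiplicative_functionalB// !psiZ !psiM; ring.
Qed.

Lemma uin_newton_iter k : uin (newton_iter k.+1) =
  uin (newton_iter k) ^+ 2 *+ 3 - uin (newton_iter k) ^+ 3 *+ 2.
Proof.
by rewrite /= uinB !uinZ !uinM !scaler_nat [_ ^+ 3]exprS !expr2.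
Qed.

(** The Newton iterates converge only modulo [J]; choosing small representatives
    of the increments makes them into a convergent series of [A]. *)
Lemma local_unit : exists y, forall psi, near_one psi -> psi y = 1.
Proof.
have Jid := left_ideal_vanishing_near_one.
have qP := quotient_seminormP mulC (banach_norm A) Jid.
have [n zn] := defect_spectral_radius.
have zE : uin z = uin x - uin x ^+ 2 by rewrite uinB uinM expr2.
rewrite zE in zn.
have [C C0 dC] := newton_increment_le qP
  (e := fun k => uin (newton_iter k)) uin_newton_iter zn.
have lift k : exists d, N d <= (C + 1) * 2^-1 ^+ k /\
    J (newton_iter k.+1 - newton_iter k - d).
  have h0 : 0 < (2^-1 : R) ^+ k by rewrite exprn_gt0//; lra.
  have : q (uin (newton_iter k.+1 - newton_iter k)) < (C + 1) * 2^-1 ^+ k.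
    rewrite uinB (le_lt_trans (dC k))//; lra.
  move=> /(quotient_seminorm_lt Jid)[j Jj /ltW jN].
  by exists (newton_iter k.+1 - newton_iter k - j); split=> //; rewrite subKr.
have [d dP] := choice lift.
have [||w wd] := @banach_series _ _ d (C + 1) 2^-1; first lra.
  by move=> k; have [] := dP k.
exists (x + w) => psi psi1; have [psiP psix] := psi1; have [psiD psiZ psiM] := psiP.
have psi0 : psi 0 = 0 by rewrite -(subrr x) multiplicative_functionalB// subrr.
pose S m := \sum_(0 <= k < m) d k.
have psiS m : psi (x + S m) = psi (newton_iter m).
  elim: m => [|m IH]; first by rewrite /S big_geq// addr0.
  rewrite /S big_nat_recr//= addrA psiD IH.
  have [_ /(_ psi psi1)] := dP m.
  rewrite !multiplicative_functionalB// => /eqP.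
  by rewrite subr_eq0 => /eqP <-; rewrite addrC subrK.
have lim1 := newton_cvg1 (fun k => newton_iterE k psiP) psix.
apply/eqP; rewrite -subr_eq0; apply/eqP/cmod_eq0/eqP.
rewrite eq_le cmod_ge0 andbT; apply/ler_addgt0Pr => e e0; rewrite add0r.
have e2 : 0 < e / 2 by rewrite divr_gt0.
have [M1 wM] := wd _ e2.
have [|M2 tM] := @geometric_small R (1 / 32) 2^-1 _ _ e2; first lra.
pose m := maxn M1 M2.
have h1 := wM m (leq_maxl _ _); have h2 := tM m (leq_maxr _ _).
have -> : psi (x + w) - 1 = psi (w - S m) + (psi (newton_iter m) - 1).
  by rewrite -psiS multiplicative_functionalB// !psiD; ring.
rewrite (le_trans (cmodD _ _))// [e]splitr lerD//.
  by rewrite (le_trans (multiplicative_functional_le mulC _ psiP)).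
by rewrite (le_trans (lim1 m))// ltW.
Qed.

End LocalUnit.

(** * Regularity and algebra norms *)

Section Spectrum.
Variables (R : realType) (A : banachAlgType R[i]).

Lemma gelfand_near (x : A) (f : spectrum A) (r : R) : 0 < r ->
  \forall g \near f, cmod (gelfand x g - gelfand x f) < r.
Proof.
move=> r0.
have xc : continuous (gelfand x : spectrum A -> R[i]^o).
  move=> g; apply: (@continuous_comp _ _ _
    (set_val : spectrum A -> {ptws A -> R[i]^o}) (fun h => h x)).
    exact: initial_continuous.
  exact: (@proj_continuous _ (fun=> R[i]^o) x).
have r0' : 0 < (r%:C%C : R[i]) by rewrite ltcR.
have /cvgrPdist_lt/(_ _ r0') := xc f.
by apply: filterS => g; rewrite distrC cmodE ltcR.
Qed.

Lemma closed_near_one (x : A) (r : R) :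
  closed [set f : spectrum A | cmod (gelfand x f - 1) <= r].
Proof.
rewrite -openC openE => f /negP; rewrite -ltNge => rf.
have := @gelfand_near x f (cmod (gelfand x f - 1) - r).
rewrite subr_gt0 => /(_ rf); apply: filterS => g gf; apply/negP; rewrite -ltNge.
have := cmodD (gelfand x g - 1) (- (gelfand x g - gelfand x f)).
have -> : gelfand x g - 1 - (gelfand x g - gelfand x f) = gelfand x f - 1 by ring.
rewrite cmodN; lra.
Qed.

Lemma closed_away_from_one (x : A) (r : R) :
  closed [set f : spectrum A | r <= cmod (gelfand x f - 1)].
Proof.
rewrite -openC openE => f /negP; rewrite -ltNge => rf.
have := @gelfand_near x f (r - cmod (gelfand x f - 1)).
rewrite subr_gt0 => /(_ rf); apply: filterS => g gf; apply/negP; rewrite -ltNge.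
have := cmodD (gelfand x f - 1) (gelfand x g - gelfand x f).
have -> : gelfand x f - 1 + (gelfand x g - gelfand x f) = gelfand x g - 1 by ring.
lra.
Qed.

End Spectrum.

Section Regular.
Variables (R : realType) (A : banachAlgType R[i]).
Hypotheses (mulC : commutative (@amul R[i] A)) (reg : regular A).

Lemma regular_hull (x : A) psi : multiplicative_functional psi ->
  (exists a, psi a != 0) -> (forall j, vanishing_near_one x j -> psi j = 0) ->
  near_one x psi.
Proof.
move=> psiP [a psia] psiJ; split=> //.
have [f fE] := multiplicative_functional_spectrum mulC psiP psia.
rewrite leNgt; apply/negP => psix.
have [|j [j0 /eqP]] := reg (@closed_near_one _ _ x (1 / 32)) (f1 := f).
  by move=> /=; rewrite fE; apply/negP; rewrite -ltNge.
rewrite fE; apply; apply: psiJ => phi [phiP phix].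
have phix0 : phi x != 0.
  apply/eqP => phi0; move: phix; rewrite phi0 sub0r cmodN cmod1; lra.
have [g gE] := multiplicative_functional_spectrum mulC phiP phix0.
by rewrite -gE; apply: j0; rewrite /= gE.
Qed.

(** Regularity applied to the closed set where [x] is at distance at least
    [1 / 32] from [1]. *)
Lemma regular_bump (x : A) (f : spectrum A) : gelfand x f = 1 ->
  exists2 u, gelfand u f != 0 &
    forall psi, multiplicative_functional psi -> psi u != 0 -> near_one x psi.
Proof.
move=> fx.
have [|u [u0 uf]] := reg (@closed_away_from_one _ _ x (1 / 32)) (f1 := f).
  by rewrite /= fx subrr cmod0; apply/negP; rewrite -ltNge; lra.
exists u => // psi psiP psiu; split=> //.
have [g gE] := multiplicative_functional_spectrum mulC psiP psiu.
rewrite leNgt; apply/negP => xg; move/eqP: psiu; apply.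
by rewrite -gE; apply: u0; rewrite /= gE ltW.
Qed.

Hypothesis ss : semisimple A.
Variable nu : algebra_norm A.

(** If not, [x] can be rescaled to take the value [1] at a character. With the
    bump [u] there and the local unit [y], the powers of [y] fix [u] modulo the
    ideal of the elements vanishing near that character, so they are not small
    for [nu]; the resulting character is near [1] at [x] yet bounded by [nu]. *)
Lemma quasi_invertible_of_small x : rnorm nu x < 1 / 2 -> quasi_invertible x.
Proof.
move=> x2; apply: contrapT => /(nonunit_character mulC)[phi phiP phi1].
have phix0 : phi x != 0 by rewrite -cmod_gt0 (lt_le_trans ltr01).
have [_ phiZ _] := phiP.
pose x1 := (phi x)^-1 *: x.
have {x2} x12 : rnorm nu x1 < 1 / 2.
  rewrite rnormZ cmodV; apply: le_lt_trans x2.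
  by rewrite ler_piMl ?rnorm_ge0// invf_le1// (lt_le_trans ltr01).
have [f fE] := multiplicative_functional_spectrum mulC phiP phix0.
have fx1 : gelfand x1 f = 1 by rewrite fE phiZ mulVf.
have hull := @regular_hull x1.
have [y yP] := local_unit mulC hull.
have [u fu uP] := regular_bump fx1.
have psi0 psi : multiplicative_functional psi -> psi u = 0 \/ near_one x1 psi.
  by move=> psiP; have [->|/uP] := eqVneq (psi u) 0; [left|right; auto].
have uy : amul y u = u.
  apply/eqP; rewrite -subr_eq0; apply/eqP/(semisimple_separates mulC ss) => psi psiP.
  have [_ _ psiM] := psiP; rewrite multiplicative_functionalB// psiM.
  have [->|/yP->] := psi0 _ psiP; first by rewrite mulr0 subr0.
  by rewrite mul1r subrr.
have Ju j : vanishing_near_one x1 j -> amul j u = 0.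
  move=> Jj; apply: (semisimple_separates mulC ss) => psi psiP.
  have [_ _ psiM] := psiP; rewrite psiM.
  have [->|/Jj->] := psi0 _ psiP; first by rewrite mulr0.
  by rewrite mul0r.
have u0 : u != 0.
  apply: contra_neq fu => ->.
  have [_ gZ _] := gelfand_multiplicative f.
  by rewrite -(scale0r (0 : A)) gZ mul0r.
have Jid := left_ideal_vanishing_near_one x1.
have [n|psi [psiP psile psiJ psiy]] := @exists_character_mod_ideal _ _ mulC nu _ Jid y.
  have [b bE] := uinX mulC y n; rewrite bE; apply: le_quotient_seminorm => // j Jj.
  have bu : amul (b - j) u = u.
    rewrite amulBl (Ju j Jj) subr0; apply: (@uin_inj _ _ mulC).
    rewrite uinM -bE; elim: (n.+1) => [|k IH]; first by rewrite mul1r.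
    by rewrite exprSr -mulrA -uinM uy.
  by have := rnormM nu (b - j) u; rewrite bu ler_pMl// rnorm_gt0.
have [|_] := hull psi psiP _ psiJ.
  by exists y; rewrite -cmod_gt0 (lt_le_trans ltr01).
have := psile x1; have := cmodB (psi x1) 1.
have := cmodD (1 - psi x1) (psi x1); rewrite subrK cmod1; lra.
Qed.

(** An inverse [e] of [1 - x] transports the neighbourhood of [0] supplied by
    [quasi_invertible_of_small] to [x]. *)
Lemma open_quasi_invertible : Q_algebra_norm nu.
Proof.
rewrite /Q_algebra_norm /Q_algebra openE => x /(quasi_invertibleP (A := A) mulC)[e xe].
set M := cmod e.1 + rnorm nu e.2 + 1.
have M0 : 0 < M by rewrite /M; have := cmod_ge0 e.1; have := rnorm_ge0 nu e.2; lra.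
have r0 : 0 < ((1 / 2 / M)%:C%C : R[i]) by rewrite ltcR !divr_gt0.
apply/nbhs_normP; exists (1 / 2 / M)%:C%C => //= y.
rewrite /ball_ /= [`|_|](rnormE nu) ltcR ltr_pdivlMr// => xyM.
pose w : A := e.1 *: (y - x) + amul e.2 (y - x).
have wE : (1 - uin mulC y) * e = 1 - uin mulC w.
  have -> : uin mulC w = uin mulC (y - x) * e.
    by rewrite mulrC; congr pair; rewrite /= ?mulr0 ?scale0r ?addr0.
  by rewrite -[X in _ = X - _]xe uinB; ring.
have : rnorm nu w < 1 / 2.
  apply: le_lt_trans xyM; rewrite -(rnormN nu (x - y)) opprB.
  have := rnormD nu (e.1 *: (y - x)) (amul e.2 (y - x)).
  have := rnormM nu e.2 (y - x); rewrite rnormZ -/w /M.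
  have := rnorm_ge0 nu (y - x); lra.
move=> /quasi_invertible_of_small/(quasi_invertibleP mulC)[e' we'].
by apply/(quasi_invertibleP (A := A) mulC); exists (e * e'); rewrite mulrA wE.
Qed.

End Regular.

Theorem theorem2p8 (R : realType) (A : banachAlgType R[i])
  (mulC : commutative (@amul R[i] A)) (ss : semisimple A) (reg : regular A)
  (nu : algebra_norm A) :
  Q_algebra_norm nu.
Proof. exact: open_quasi_invertible. Qed.
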